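(* Let $T>0$, let $Z$ be a Brownian motion, $g(t,s)$ a deterministic measurable kernel and $Y_t=\int_0^tg(t,s)\,dZ_s$, $t\in[0,T]$. Assume that for some $\alpha\in\mathbb R$, $\beta>-\frac12$, $\gamma>-\frac12$ with $\alpha+\beta+\gamma>-\frac12$ and some $\delta>0$: (B1) there is a constant $C$ with $|g(t,u)|\le Ct^\alpha u^\beta(t-u)^\gamma$ for all $0<u<t\le T$; (B2) there is a function $h(t,s,u)$ such that $|g(t,u)-g(s,u)|\le|t-s|^\delta h(t,s,u)$ for all $0<u<s<t\le T$, and $\sup_{0<s<t\le T}\int_0^s|h(t,s,u)|^2\,du<\infty$. Let $\kappa=\alpha+\beta+\gamma$ if $\alpha+\beta<0$ and $\kappa=\gamma$ if $\alpha+\beta\ge0$. Then for all $p\ge2$ there is a constant $C$ such that for all $0\le s<t\le T$ $$\mathbf E|Y_t-Y_s|^p\le C(t-s)^{p\min\{\kappa+\frac12,\,\delta\}}.$$ If $\kappa>-\frac12$, then the trajectories of $Y$ are (up to modification) a.s. Hölder continuous up to order $\min\{\kappa+\frac12,\delta\}$.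
   Context: ''Hölder continuous up to order $\rho$'' means Hölder continuous of every order in $(0,\rho)$. *)

(* Defs.v *)
From HB Require Import structures.
From mathcomp Require Import all_boot all_order all_algebra.
From mathcomp Require Import all_classical all_reals all_analysis.

Set Implicit Arguments.
Unset Strict Implicit.
Unset Printing Implicit Defensive.

Import Order.TTheory GRing.Theory Num.Theory.
Import numFieldNormedType.Exports.

Local Open Scope classical_set_scope.
Local Open Scope ring_scope.

(* Brownian motion on the time interval [0, T]: it starts at 0 and has
   continuous paths (both almost surely), its increment over [s, t] is
   N(0, t - s), and its increments over consecutive intervals are mutually
   independent.  Only the values Z t with 0 <= t <= T matter.
   The second parameter of [normal_prob] is the standard deviation.  In the
   last clause a finite sequence t_0 <= ... <= t_n is the beginning of a
   nondecreasing sequence indexed by nat; taking B i = setT drops the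
   i-th increment, so the product rule covers all subfamilies. *)
Definition brownian_motion (R : realType) (d : measure_display)
    (Omega : measurableType d) (P : probability Omega R) (T : R)
    (Z : R -> {RV P >-> R}) : Prop :=
  [/\ {ae P, forall w, Z 0 w = 0},
      (forall s t : R, 0 <= s -> s < t -> t <= T ->
         forall A : set R, measurable A ->
         P [set w | A (Z t w - Z s w)] = normal_prob 0 (Num.sqrt (t - s)) A),
      (forall (n : nat) (t : nat -> R) (B : nat -> set R),
         (forall i, 0 <= t i <= T) ->
         {homo t : i j / (i <= j)%N >-> i <= j} ->
         (forall i, measurable (B i)) ->
         P [set w | forall i, (i < n)%N -> B i (Z (t i.+1) w - Z (t i) w)] =
         (\prod_(i < n) P [set w | B i (Z (t i.+1) w - Z (t i) w)%R])%E)
    & {ae P, forall w, {within `[0, T], continuous (fun t => Z t w)}} ].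

(* A list of triples (a, b, c) encodes the step function
   \sum c * \1_]a, b]; the intervals are allowed to overlap. *)
Definition step_fun (R : realType) (phi : seq (R * R * R)) (u : R) : R :=
  \sum_(k <- phi) k.2 * \1_(`]k.1.1, k.1.2]%classic) u.

Definition step_in (R : realType) (t : R) (phi : seq (R * R * R)) : Prop :=
  forall k, k \in phi -> [/\ 0 <= k.1.1, k.1.1 <= k.1.2 & k.1.2 <= t].

Definition step_integral (R : realType) (Omega : Type) (Z : R -> Omega -> R)
    (phi : seq (R * R * R)) (w : Omega) : R :=
  \sum_(k <- phi) k.2 * (Z k.1.2 w - Z k.1.1 w).

(* X is (a version of) the Wiener integral \int_0^t f(u) dZ_u: the limit in
   L^2(P) of the integrals of step functions that converge to f in
   L^2([0, t]). *)
Definition is_wiener_integral (R : realType) (d : measure_display)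
    (Omega : measurableType d) (P : probability Omega R)
    (Z : R -> {RV P >-> R}) (t : R) (f : R -> R) (X : {RV P >-> R}) : Prop :=
  exists phi : nat -> seq (R * R * R),
    [/\ forall n, step_in t (phi n),
        (\int[lebesgue_measure]_(u in `[0%R, t])
            (`|step_fun (phi n) u - f u| ^+ 2)%:E)%E
          @[n --> \oo] --> 0%E
      & ('E_P[fun w => (`|step_integral Z (phi n) w - X w| ^+ 2)%R])%E
          @[n --> \oo] --> 0%E].

Definition kappa (R : realType) (alpha beta gamma : R) : R :=
  if alpha + beta < 0 then alpha + beta + gamma else gamma.

Definition holder_on (R : realType) (D : set R) (lambda : R) (f : R -> R) :
    Prop :=
  exists K : R, forall s t : R, D s -> D t ->
    `|f t - f s| <= K * `|t - s| `^ lambda.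

Definition holder_up_to (R : realType) (D : set R) (rho : R) (f : R -> R) :
    Prop :=
  forall lambda : R, 0 < lambda -> lambda < rho -> holder_on D lambda f.

Definition modification_on (R : realType) (d : measure_display)
    (Omega : measurableType d) (P : probability Omega R) (D : set R)
    (Y Y' : R -> {RV P >-> R}) : Prop :=
  forall t : R, D t -> {ae P, forall w, Y' t w = Y t w}.

(* Main.v *)
(* By independence and normality of the Brownian increments, the integral I of a
   step function phi satisfies E exp (l I) = exp (l^2 v / 2) with
   v = \int phi^2; combined with |x|^p <= p^p (exp x + exp (- x)) this gives
   E |I|^p <= C_p v^(p/2), and the bound passes to L^2 limits.  Hence
   E |Y_t - Y_s|^p is controlled by the p-th power of the L^2 norm of
   g(t, .) - g(s, .) 1_[0, s].  Its square is at most C (t - s)^(2 delta) on [0, s]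
   by (B2).  On ]s, t] it is \int_s^t g(t, u)^2 du, which (B1) bounds by
   C t^(2 (alpha + beta)) (t - s)^(2 gamma + 1) after separating u < t / 2 from
   u >= t / 2, hence by C (t - s)^(2 kappa + 1).
   Path regularity follows by dyadic chaining: summable moments bound all dyadic
   increments of level n by K 2^(- lambda n), for each lambda below the critical
   order. *)

Require Import Defs.
From HB Require Import structures.
From mathcomp Require Import all_boot all_order all_algebra.
From mathcomp Require Import all_classical all_reals all_analysis.
From mathcomp Require Import measurable_realfun.
From mathcomp Require Import ring lra zify.

Import Order.TTheory GRing.Theory Num.Theory.
Import numFieldNormedType.Exports.

Local Open Scope classical_set_scope.
Local Open Scope ring_scope.

Set Implicit Arguments.
Unset Strict Implicit.

(** * Integrals *)

(** Wiener integrals enter only as L^2 limits of step integrals, and independence only as a product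
    rule for probabilities. Expectations of products therefore have to be built up from indicators,
    and no Gaussian law of the limit is identified: an upper bound on moments is what survives the
    limit, at the price of constants such as 2^p. Since exp (x / sigma) has to make sense, these
    bounds use a strictly positive upper bound sigma of the L^2 norm, not the norm itself. The two
    cases of kappa come from t^(2 (alpha + beta)): a negative power is at most the same power of t -
    s <= t, a nonnegative one is at most its value at T. For the paths, p-th moments give here only
    orders up to m - 2 / p, where m is the critical order, so every lambda uses its own p; yet the
    modification has to be one process for all lambda. It is defined from the values of Y at dyadic
    points without reference to lambda. *)

Section simple_functions.
Import HBNNSimple.

(* Unlike [ge0_le_integral], [f2] need not be measurable: the integral of a
   nonnegative function is a supremum over simple functions below it.  This matters
   because no measurability is assumed of the function [h] in (B2). *)
Lemma le_integral_nonneg (d : measure_display) (U : measurableType d)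
    (R : realType) (mu : {measure set U -> \bar R}) (D : set U)
    (f1 f2 : U -> \bar R) :
  (forall x, D x -> 0 <= f1 x)%E -> (forall x, D x -> f1 x <= f2 x)%E ->
  (\int[mu]_(x in D) f1 x <= \int[mu]_(x in D) f2 x)%E.
Proof.
move=> f10 f12; rewrite !(integral_mkcond D).
have h10 x : (0 <= (f1 \_ D) x)%E by exact: erestrict_ge0.
have h20 x : (0 <= (f2 \_ D) x)%E.
  by apply: erestrict_ge0 => t Dt; exact: le_trans (f10 _ Dt) (f12 _ Dt).
rewrite !ge0_integralTE//; apply: ereal_sup_le => _ [h /= hf1 <-].
exists h => //= x.
by apply: le_trans (hf1 x) _; exact: lee_restrict.
Qed.

Section weighted_law.
Local Open Scope ereal_scope.
Context (R : realType) (d1 d2 : measure_display).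
Context (U1 : measurableType d1) (U2 : measurableType d2).
Context (mu1 : {measure set U1 -> \bar R}) (mu2 : {measure set U2 -> \bar R}).
Context (W X1 : U1 -> R) (X2 : U2 -> R) (c : R).
Hypotheses (W0 : forall w, (0 <= W w)%R) (mW : measurable_fun setT W).
Hypotheses (mX1 : measurable_fun setT X1) (mX2 : measurable_fun setT X2).
Hypothesis law : forall A : set R, measurable A ->
  \int[mu1]_w (W w * \1_A (X1 w))%:E = c%:E * mu2 (X2 @^-1` A).

Let mcomp1 (f : R -> R) : measurable_fun setT f ->
  measurable_fun setT (fun w => (W w * f (X1 w))%:E).
Proof.
by move=> mf; apply/measurable_EFinP/measurable_funM => //; exact: measurableT_comp.
Qed.

Let weighted_law_nnsfun (h : {nnsfun R >-> R}) :
  \int[mu1]_w (W w * h (X1 w))%:E = c%:E * \int[mu2]_w (h (X2 w))%:E.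
Proof.
pose r := finmap.enum_fset (fset_set (range h)).
have hE x : h x = (\sum_(y <- r) y * \1_(h @^-1` [set y]) x)%R.
  by rewrite [LHS]fimfunE fsbig_finite.
have t0 (y x : R) : (0 <= y * \1_(h @^-1` [set y]) x)%R.
  by rewrite -lee_fin EFinM nnfun_muleindic_ge0.
have mA (y : R) : measurable (h @^-1` [set y]) by exact: measurable_sfunP.
have mi (y : R) : measurable_fun setT (fun x => y * \1_(h @^-1` [set y]) x)%R.
  by apply: measurable_funM => //; exact: measurable_indic.
under eq_integral do rewrite hE mulr_sumr -sumEFin.
under [in RHS]eq_integral do rewrite hE -sumEFin.
rewrite ge0_integral_sum//; last 2 first.
- by move=> y; apply: mcomp1 (mi y).
- by move=> y x _; rewrite lee_fin mulr_ge0.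
rewrite ge0_integral_sum//; last 2 first.
- by move=> y; apply/measurable_EFinP; apply: measurableT_comp (mi y) _.
- by move=> y x _; rewrite lee_fin.
rewrite ge0_sume_distrr; last first.
  by move=> y _; apply: integral_ge0 => x _; rewrite lee_fin.
apply: eq_bigr => y _.
(* A negative value has an empty level set because [h] is nonnegative; the scalar [y] is pulled out
   of the integrals only when [0 <= y]. *)
have [y0|y0] := ltP y 0%R.
  have -> : h @^-1` [set y] = set0 by exact: preimage_nnfun0.
  under eq_integral do rewrite indic0 mulr0 mulr0.
  under [in RHS]eq_integral do rewrite indic0 mulr0.
  by rewrite !integral0 mule0.
under eq_integral do rewrite mulrCA EFinM.
under [in RHS]eq_integral do rewrite EFinM.
rewrite ge0_integralZl_EFin//; last 2 first.
- by move=> x _; rewrite lee_fin mulr_ge0.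
- by apply: mcomp1; exact: measurable_indic.
rewrite ge0_integralZl_EFin//; last first.
  apply/measurable_EFinP.
  exact: (measurableT_comp (measurable_indic (mA y)) mX2).
rewrite law// muleCA; congr (_ * (_ * _)).
have mXA : measurable (X2 @^-1` (h @^-1` [set y])).
  by rewrite -[_ @^-1` _]setTI; exact: mX2.
by rewrite -[in LHS](setIT (X2 @^-1` _)) -integral_indic.
Qed.

(** The hypothesis [law] is the case of indicators; finite sums over level sets and monotone
    convergence give the rest. The weight [W] serves two purposes: as the product of the other
    factors it makes this one step of independence, as a density it makes this integration against a
    law. *)
Lemma weighted_law (f : R -> R) : measurable_fun setT f ->
  (forall x, (0 <= f x)%R) ->
  \int[mu1]_w (W w * f (X1 w))%:E = c%:E * \int[mu2]_w (f (X2 w))%:E.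
Proof.
move=> mf f0.
have mfE : measurable_fun setT (EFin \o f) by exact/measurable_EFinP.
pose h := nnsfun_approx measurableT mfE.
have hf x : (h n x)%:E @[n --> \oo] --> (f x)%:E.
  by apply: (@cvg_nnsfun_approx _ _ _ _ measurableT _ mfE) => // y _ /=; rewrite lee_fin.
have ndh x m n : (m <= n)%N -> (h m x <= h n x)%R.
  by move=> mn; have /lefP := nd_nnsfun_approx measurableT mfE mn; exact.
have L : \int[mu1]_w (W w * h n (X1 w))%:E @[n --> \oo] -->
    \int[mu1]_w (W w * f (X1 w))%:E.
  have -> : \int[mu1]_w (W w * f (X1 w))%:E =
     \int[mu1]_w limn (fun n => (W w * h n (X1 w))%:E).
    apply: eq_integral => w _; apply/esym/cvg_lim => //.
    by under eq_fun do rewrite EFinM; rewrite EFinM; apply: cvgeZl.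
  apply: cvg_monotone_convergence => //.
  - by move=> n; exact: mcomp1.
  - by move=> n x _; rewrite lee_fin mulr_ge0.
  - by move=> x _ m n mn; rewrite lee_fin ler_wpM2l// ndh.
have Rr : \int[mu2]_w (h n (X2 w))%:E @[n --> \oo] --> \int[mu2]_w (f (X2 w))%:E.
  have -> : \int[mu2]_w (f (X2 w))%:E =
     \int[mu2]_w limn (fun n => (h n (X2 w))%:E).
    by apply: eq_integral => w _; apply/esym/cvg_lim.
  apply: cvg_monotone_convergence => //.
  - by move=> n; apply/measurable_EFinP; exact: measurableT_comp.
  - by move=> n x _; rewrite lee_fin.
  - by move=> x _ m n mn; rewrite lee_fin ndh.
suff L' : \int[mu1]_w (W w * h n (X1 w))%:E @[n --> \oo] -->
    c%:E * \int[mu2]_w (f (X2 w))%:E by exact: (cvg_unique _ L L').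
rewrite (_ : (fun n => _) = (fun n => c%:E * \int[mu2]_w (h n (X2 w))%:E)).
  exact: cvgeZl.
by apply/funext => n; exact: weighted_law_nnsfun.
Qed.

End weighted_law.

End simple_functions.

(** * Moments of Wiener integrals *)

(** The sets [B i] in the product rule are arbitrary, so one of them can range over all measurable
    sets while the other factors stay fixed as a weight; [weighted_law] then trades the indicator at
    that index for [f]. *)
Lemma prod_indep (d : measure_display) (U : measurableType d) (R : realType)
    (P : probability U R) (n : nat) (X : nat -> U -> R) (f : nat -> R -> R)
    (m : nat -> R) :
  (forall i, measurable_fun setT (X i)) ->
  (forall B : nat -> set R, (forall i, measurable (B i)) ->
     P [set w | forall i, (i < n)%N -> B i (X i w)] =
     (\prod_(i < n) P [set w | B i (X i w)])%E) ->
  (forall i, measurable_fun setT (f i)) -> (forall i x, 0 <= f i x) ->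
  (forall i, \int[P]_w (f i (X i w))%:E = (m i)%:E)%E ->
  (\int[P]_w (\prod_(i < n) f i (X i w))%:E = (\prod_(i < n) m i)%:E)%E.
Proof.
move=> mX indep mf f0 fm.
have mXB i B : measurable B -> measurable [set w | B (X i w)].
  by move=> mB; rewrite -[X in measurable X]setTI; exact: mX.
pose F j (B : nat -> set R) (i : nat) w : R :=
  if (i < j)%N then f i (X i w) else \1_(B i) (X i w).
pose q j (B : nat -> set R) (i : nat) : R :=
  if (i < j)%N then m i else fine (P [set w | B i (X i w)]).
have mF j B i : (forall i, measurable (B i)) -> measurable_fun setT (F j B i).
  move=> mB; rewrite /F; case: (i < j)%N; first exact: measurableT_comp.
  exact: (measurableT_comp (measurable_indic (mB i)) (mX i)).
have F0 j B i w : 0 <= F j B i w by rewrite /F; case: ifP.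
(* The indicators are replaced by the functions [f i] one index at a time. *)
have main j B : (j <= n)%N -> (forall i, measurable (B i)) ->
    (\int[P]_w (\prod_(i < n) F j B i w)%:E = (\prod_(i < n) q j B i)%:E)%E.
  elim: j B => [B _ mB|j IH B jn mB].
    transitivity (P [set w | forall i, (i < n)%N -> B i (X i w)]).
      rewrite -[in RHS](setIT [set w | _]) -integral_indic//; last first.
        rewrite (_ : [set w | _] =
          \bigcap_(i in [set i | (i < n)%N]) [set w | B i (X i w)]).
          by apply: bigcap_measurableType => i _; exact: mXB.
        by apply/seteqP; split.
      apply: eq_integral => w _; congr EFin.
      rewrite indicE; have [|] := boolP (w \in _) => [/set_mem /= Bw|nB].
        by rewrite big1// => i _; rewrite /F ltn0 indicE mem_set//; exact: Bw.
      have [i nBi] : exists i : 'I_n, ~ B i (X i w).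
        apply: contrapT => H; move/negP: nB; apply; apply/mem_set => i ilt.
        by apply: contrapT => nBi; apply: H; exists (Ordinal ilt).
      by rewrite (bigD1 i)//= /F ltn0 indicE memNset// mul0r.
    rewrite indep// -prodEFin; apply: eq_bigr => i _.
    by rewrite /q ltn0 fineK// fin_num_measure//; exact: mXB.
  pose jn' := Ordinal jn.
  pose W w := \prod_(i < n | i != jn') F j.+1 B i w.
  pose c := \prod_(i < n | i != jn') q j.+1 B i.
  have law (A : set R) : measurable A ->
      (\int[P]_w (W w * \1_A (X j w))%:E = c%:E * P (X j @^-1` A))%E.
    (* [B'] puts [A] at index [j], where [F j] still shows an indicator; at the other indices [F j]
       and [F j.+1] agree. *)
    move=> mA; pose B' i := if i == j then A else B i.
    have mB' i : measurable (B' i) by rewrite /B'; case: ifP.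
    have FB i w : i != j -> F j B' i w = F j.+1 B i w.
      by move=> ij; rewrite /F /B' [(i < j.+1)%N]ltnS [(i <= j)%N]leq_eqVlt (negbTE ij).
    have qB i : i != j -> q j B' i = q j.+1 B i.
      by move=> ij; rewrite /q /B' [(i < j.+1)%N]ltnS [(i <= j)%N]leq_eqVlt (negbTE ij).
    have FA w : F j B' j w = \1_A (X j w) by rewrite /F /B' ltnn eqxx.
    have qA : q j B' j = fine (P (X j @^-1` A)) by rewrite /q /B' ltnn eqxx.
    rewrite -[P _]fineK; last by rewrite fin_num_measure//; exact: mXB.
    rewrite -EFinM mulrC -qA.
    have <- : \prod_(i < n | i != jn') q j B' i = c.
      by apply: eq_bigr => i ij; exact: qB.
    have := IH B' (ltnW jn) mB'.
    rewrite (bigD1 jn')//= => <-.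
    apply: eq_integral => w _; congr EFin.
    rewrite [RHS](bigD1 jn')//= mulrC FA; congr (_ * _).
    by apply: eq_bigr => i ij; rewrite FB.
  have W0 w : 0 <= W w by apply: prodr_ge0.
  have mW : measurable_fun setT W.
    rewrite /W; under eq_fun do rewrite big_mkcond/=.
    apply: measurable_prod => i _; case: (i != jn') => //; exact: mF.
  have := weighted_law W0 mW (mX j) (mX j) law (mf j) (f0 j).
  rewrite fm -EFinM => E.
  have Fj w : F j.+1 B j w = f j (X j w) by rewrite /F ltnSn.
  have qj : q j.+1 B j = m j by rewrite /q ltnSn.
  rewrite (bigD1 jn')//= qj mulrC -/c -E.
  apply: eq_integral => w _; congr EFin.
  by rewrite (bigD1 jn')//= Fj mulrC.
have := main n (fun=> setT) (leqnn n) (fun=> measurableT).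
rewrite (eq_bigr (fun i : 'I_n => m i)); last by move=> i _; rewrite /q ltn_ord.
move=> <-; apply: eq_integral => w _; congr EFin.
by apply: eq_bigr => i _; rewrite /F ltn_ord.
Qed.

(** * Exponential moments of Brownian increments and step integrals *)

Lemma normal_mgf (d : measure_display) (U : measurableType d) (R : realType)
    (P : probability U R) (X : U -> R) (sigma c : R) : sigma != 0 ->
  measurable_fun setT X ->
  (forall A, measurable A -> P (X @^-1` A) = normal_prob 0 sigma A) ->
  (\int[P]_w (expR (c * X w))%:E = (expR (c ^+ 2 * sigma ^+ 2 / 2))%:E)%E.
Proof.
move=> s0 mX lawX.
have W0 := normal_pdf_ge0 (0 : R) sigma.
have mW := measurable_normal_pdf (0 : R) sigma.
(* With Lebesgue measure weighted by the density and the identity as variable, [weighted_law]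
   becomes the transfer formula for the law of [X]. *)
have law (A : set R) : measurable A ->
    (\int[lebesgue_measure]_x (normal_pdf 0 sigma x * \1_A (idfun x))%:E =
     1%:E * P (X @^-1` A))%E.
  move=> mA; rewrite mul1e lawX// [RHS]integral_mkcond.
  apply: eq_integral => x _; rewrite patchE indicE.
  by case: ifP => _; rewrite ?mulr1 ?mulr0.
have mexp : measurable_fun setT (fun x : R => expR (c * x)).
  by apply: measurableT_comp => //; exact: measurable_funM.
have mid : measurable_fun setT (idfun : R -> R) by exact: measurable_id.
have := weighted_law (mu1 := @lebesgue_measure R) (mu2 := P) (c := 1) W0 mW mid mX law mexp (fun=> expR_ge0 _).
rewrite mul1e => <-.
(* Completing the square: exp (c x) times the N(0, sigma^2) density is a multiple
   of the N(c sigma^2, sigma^2) density. *)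
transitivity (\int[lebesgue_measure]_x ((expR (c ^+ 2 * sigma ^+ 2 / 2))%:E *
   (normal_pdf (c * sigma ^+ 2) sigma x)%:E))%E.
  apply: eq_integral => x _; rewrite -EFinM; congr EFin.
  rewrite !normal_pdfE//= [RHS]mulrCA -[LHS]mulrA; congr (_ * _).
  rewrite /normal_fun -!expRD; congr expR; by field.
rewrite ge0_integralZl_EFin//; last 2 first.
- by move=> x _; rewrite lee_fin; exact: normal_pdf_ge0.
- by apply/measurable_EFinP; exact: measurable_normal_pdf.
by rewrite integral_normal_pdf// mule1.
Qed.

Section brownian_mgf.
Context (R : realType) (d : measure_display) (Omega : measurableType d).
Context (P : probability Omega R) (T : R) (Z : R -> {RV P >-> R}).
Hypothesis hZ : brownian_motion T Z.

Lemma brownian_incr_mgf (s t c : R) : 0 <= s -> s <= t -> t <= T ->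
  (\int[P]_w (expR (c * (Z t w - Z s w)))%:E =
   (expR (c ^+ 2 * (t - s) / 2))%:E)%E.
Proof.
move=> s0 st tT; have [_ hnorm _ _] := hZ.
(* A grid may repeat a point; the increment is then 0, and the normal law is given for [s < t]. *)
move: st; rewrite le_eqVlt => /predU1P[<-|st].
  rewrite subrr mulr0 mul0r expR0.
  under eq_integral do rewrite subrr mulr0 expR0.
  by rewrite integral_cst//= probability_setT mule1.
have q0 : 0 < Num.sqrt (t - s) by rewrite sqrtr_gt0 subr_gt0.
rewrite (@normal_mgf _ _ _ P (fun w => Z t w - Z s w) (Num.sqrt (t - s)) c).
- by rewrite sqr_sqrtr// subr_ge0 ltW.
- by rewrite gt_eqF.
- exact: measurable_funB.
- by move=> A mA; exact: hnorm.
Qed.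

Lemma brownian_grid_mgf (n : nat) (t c : nat -> R) :
  (forall i, 0 <= t i <= T) -> {homo t : i j / (i <= j)%N >-> i <= j} ->
  (\int[P]_w (expR (\sum_(i < n) c i * (Z (t i.+1) w - Z (t i) w)))%:E =
   (expR (2^-1 * \sum_(i < n) c i ^+ 2 * (t i.+1 - t i)))%:E)%E.
Proof.
move=> t0T tnd; have [_ _ hind _] := hZ.
under eq_integral do rewrite expR_sum.
rewrite (@prod_indep _ _ _ P n (fun i w => Z (t i.+1) w - Z (t i) w)
  (fun i x => expR (c i * x)) (fun i => expR (c i ^+ 2 * (t i.+1 - t i) / 2))).
- by rewrite -expR_sum mulr_sumr; congr (expR _)%:E; apply: eq_bigr => i _; rewrite mulrC.
- by move=> i; exact: measurable_funB.
- by move=> B mB; exact: hind.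
- by move=> i; apply: measurableT_comp => //; exact: measurable_funM.
- by move=> i x; exact: expR_ge0.
- move=> i; have /andP[ti0 _] := t0T i; have /andP[_ tiT] := t0T i.+1.
  by rewrite brownian_incr_mgf// tnd.
Qed.

End brownian_mgf.

Section step_grid.
Context (R : realType) (T : R) (hT : 0 <= T) (phi : seq (R * R * R)).
Hypothesis hphi : step_in T phi.

(* Both Z and u |-> 1_(u <= x), as functions of x, are substituted for [F]. *)
Lemma step_grid : exists (n : nat) (t c : nat -> R),
  [/\ forall i, 0 <= t i <= T, {homo t : i j / (i <= j)%N >-> i <= j}
    & forall F : R -> R,
      \sum_(k <- phi) k.2 * (F k.1.2 - F k.1.1) =
      \sum_(i < n) c i * (F (t i.+1) - F (t i))].
Proof.
pose s := sort <=%R (flatten [seq [:: k.1.1; k.1.2] | k <- phi]).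
(* Beyond the last endpoint the grid stays at the default [T], so [t] is a nondecreasing sequence on
   all of nat, as in the independence clause. [c i] adds up the heights of the triples whose
   interval covers the cell from [t i] to [t i.+1]; each difference of [F] telescopes over its
   cells. *)
pose t i := nth T s i.
pose c i := \sum_(k <- phi)
  (if (index k.1.1 s <= i < index k.1.2 s)%N then k.2 else 0).
have s_sorted : sorted <=%R s by exact/sort_sorted/le_total.
have ms k : k \in phi -> k.1.1 \in s /\ k.1.2 \in s.
  move=> kphi; rewrite !mem_sort; split; apply/flattenP;
  by exists [:: k.1.1; k.1.2]; rewrite ?inE ?eqxx ?orbT//; apply/mapP; exists k.
have sT x : x \in s -> 0 <= x <= T.
  rewrite mem_sort => /flattenP[_ /mapP[k /hphi[a0 ab bT] ->]].
  rewrite !inE => /orP[] /eqP ->.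
    by rewrite a0 (le_trans ab).
  by rewrite bT (le_trans a0).
have tT i : 0 <= t i <= T.
  rewrite /t; have [ilt|ige] := ltnP i (size s); first exact/sT/mem_nth.
  by rewrite nth_default// hT lexx.
have tnd : {homo t : i j / (i <= j)%N >-> i <= j}.
  move=> i j ij; have [jlt|jge] := ltnP j (size s).
    apply: (sorted_leq_nth le_trans le_refl _ s_sorted) => //.
    by rewrite inE (leq_ltn_trans ij).
  by rewrite {2}/t nth_default//; have /andP[] := tT i.
exists (size s), t, c; split => // F.
under [RHS]eq_bigr do rewrite mulr_suml.
rewrite exchange_big/= big_seq [RHS]big_seq; apply: eq_bigr => k kphi.
have [/= a0 ab bT] := hphi kphi; have [ain bin] := ms _ kphi.
have le_idx : (index k.1.1 s <= index k.1.2 s)%N.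
  rewrite leqNgt; apply/negP => lt_idx.
  have := tnd _ _ (ltnW lt_idx); rewrite /t !nth_index// => ba.
  by move: lt_idx; rewrite (le_anti (introT andP (conj ab ba))) ltnn.
rewrite -{1}(nth_index T bin) -{1}(nth_index T ain) -/(t _) -/(t _).
rewrite -(telescope_sumr (F \o t) le_idx)/= mulr_sumr.
rewrite [LHS](big_nat_widen _ _ (size s)); last by rewrite ltnW// index_mem.
rewrite [LHS](big_nat_widenl _ 0)// big_mkord big_mkcond/=.
apply: eq_bigr => i _; rewrite andbC.
by case: ifP => _; rewrite ?mul0r.
Qed.

End step_grid.

(** The cells ]t i, t i.+1] are disjoint, so the cross terms of the square vanish. The differences
    of truth values are what [step_grid] yields for F x = 1_(u <= x). *)
Lemma sqr_sum_steps (R : realType) (n : nat) (t c : nat -> R) (u : R) :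
  {homo t : i j / (i <= j)%N >-> i <= j} ->
  (\sum_(i < n) c i * ((u <= t i.+1)%R%:R - (u <= t i)%R%:R)) ^+ 2 =
  \sum_(i < n) c i ^+ 2 * \1_(`]t i, t i.+1]%classic) u.
Proof.
move=> tnd; elim: n => [|n IH]; first by rewrite !big_ord0 expr0n.
have DE i : \1_(`]t i, t i.+1]%classic) u = (u <= t i.+1)%R%:R - (u <= t i)%R%:R :> R.
  rewrite indicE mem_setE/= in_itv/=; case: (lerP u (t i)) => /= [uti|tiu].
    by rewrite (le_trans uti (tnd _ _ (leqnSn i))) subrr.
  by rewrite subr0.
rewrite !big_ord_recr/= -IH sqrrD.
have -> : (\sum_(i < n) c i * ((u <= t i.+1)%R%:R - (u <= t i)%R%:R)) *
    (c n * ((u <= t n.+1)%R%:R - (u <= t n)%R%:R)) = 0.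
  rewrite mulr_suml big1// => i _; case: (lerP u (t n)) => [utn|tnu].
    by rewrite (le_trans utn (tnd _ _ (leqnSn n))) subrr mulr0 mulr0.
  have ti1 : t i.+1 < u by apply: le_lt_trans tnu; exact: tnd.
  have ti0 : t i < u by apply: le_lt_trans ti1; exact: tnd.
  by rewrite !leNgt ti1 ti0 subrr mulr0 mul0r.
rewrite mul0rn addr0 exprMn DE; congr (_ + _ * _).
case: (lerP u (t n)) => [utn|_].
  by rewrite (le_trans utn (tnd _ _ (leqnSn n))) subrr expr0n.
by rewrite subr0; case: (u <= t n.+1); rewrite ?expr1n ?expr0n.
Qed.

(** The inequality y <= exp y at y = x / p, raised to the power [p]. *)
Lemma powR_le_expR (R : realType) (p x : R) : 0 < p -> 0 <= x ->
  x `^ p <= p `^ p * expR x.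
Proof.
move=> p0 x0.
have xE : x <= p * expR (x / p).
  rewrite mulrC -ler_pdivrMr//; apply: le_trans (expR_ge1Dx _).
  by rewrite lerDr.
have -> : expR x = expR (x / p) `^ p.
  by rewrite /powR gt_eqF ?expR_gt0// expRK mulrCA divff ?mulr1// gt_eqF.
rewrite -powRM ?expR_ge0 ?(ltW p0)//.
by apply: ge0_ler_powR; rewrite ?nnegrE ?mulr_ge0 ?expR_ge0 ?(ltW p0).
Qed.

Section step_moment.
Context (R : realType) (d : measure_display) (Omega : measurableType d).
Context (P : probability Omega R) (T : R) (Z : R -> {RV P >-> R}).
Hypothesis hZ : brownian_motion T Z.

(** One grid serves both claims: it turns [phi] into a sum over disjoint cells, which gives [v], and
    its integral into a combination of consecutive increments, which gives the exponential moments.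
    That the same [v] occurs in both is the Wiener isometry. *)
Lemma step_integral_mgf (t : R) (phi : seq (R * R * R)) :
  0 <= t -> t <= T -> step_in t phi ->
  exists2 v : R,
    (\int[lebesgue_measure]_(u in `[0%R, t]) (step_fun phi u ^+ 2)%:E = v%:E)%E &
    forall l : R, (\int[P]_w (expR (l * step_integral Z phi w))%:E =
      (expR (l ^+ 2 * v / 2))%:E)%E.
Proof.
move=> t0 tT hphi; have [n [s [c [st snd sE]]]] := step_grid t0 hphi.
exists (\sum_(i < n) c i ^+ 2 * (s i.+1 - s i)).
  have stepE u : step_fun phi u =
      \sum_(i < n) c i * ((u <= s i.+1)%R%:R - (u <= s i)%R%:R).
    rewrite -(sE (fun x => (u <= x)%R%:R)) /step_fun big_seq [RHS]big_seq.
    apply: eq_bigr => k /hphi[_ ab _]; congr (_ * _).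
    rewrite indicE mem_setE/= in_itv/=; case: (lerP u k.1.1) => [ua|_] /=.
      by rewrite (le_trans ua ab) subrr.
    by rewrite subr0.
  under eq_integral do rewrite stepE sqr_sum_steps// -sumEFin.
  rewrite ge0_integral_sum//; last 2 first.
  - move=> i; apply/measurable_EFinP/measurable_funM => //.
  - by move=> i x _; rewrite lee_fin mulr_ge0 ?sqr_ge0.
  rewrite -sumEFin; apply: eq_bigr => i _.
  under eq_integral do rewrite EFinM.
  rewrite ge0_integralZl_EFin ?sqr_ge0//; last first.
    by apply/measurable_EFinP; exact: measurable_indic.
  rewrite integral_indic//= (_ : _ `&` _ = `]s i, s i.+1]%classic).
    rewrite lebesgue_measure_itv/= lte_fin; case: ltP => [_|ge]; first by [].
    have -> : s i.+1 = s i by apply/le_anti; rewrite ge snd.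
    by rewrite subrr mulr0 mule0.
  apply/seteqP; split => x /=; first by case.
  rewrite !in_itv/= => /andP[sx xs]; have /andP[si0 _] := st i.
  have /andP[_ sit] := st i.+1.
  by rewrite sx xs (le_trans si0 (ltW sx)) (le_trans xs sit).
move=> l.
have -> : (fun w => (expR (l * step_integral Z phi w))%:E) =
   (fun w => (expR (\sum_(i < n) (l * c i) * (Z (s i.+1) w - Z (s i) w)))%:E).
  apply/funext => w; rewrite /step_integral (sE (fun x => Z x w)) mulr_sumr.
  by congr (expR _)%:E; apply: eq_bigr => i _; rewrite mulrA.
rewrite (brownian_grid_mgf hZ n (fun i => l * c i))//; last first.
  by move=> i; have /andP[-> /le_trans ->] := st i.
congr (expR _)%:E; rewrite [RHS]mulrC; congr (_ * _).
by rewrite mulr_sumr; apply: eq_bigr => i _; rewrite exprMn mulrA.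
Qed.

Lemma measurable_step_integral (phi : seq (R * R * R)) :
  measurable_fun setT (step_integral Z phi).
Proof.
rewrite /step_integral; apply: measurable_sum => k.
by apply: measurable_funM => //; exact: measurable_funB.
Qed.

(** Taking l = 1 / sigma and l = - 1 / sigma normalises the variance to at most 1, so each
    exponential moment is at most exp (1/2). The factor 2 counts the two signs, and sigma^p comes
    from homogeneity. *)
Lemma step_integral_moment (p t sigma : R) (phi : seq (R * R * R)) :
  0 < p -> 0 <= t -> t <= T -> step_in t phi -> 0 < sigma ->
  (\int[lebesgue_measure]_(u in `[0%R, t]) (step_fun phi u ^+ 2)%:E
     <= (sigma ^+ 2)%:E)%E ->
  (\int[P]_w (`|step_integral Z phi w| `^ p)%:E
     <= (p `^ p * 2 * expR 2^-1 * sigma `^ p)%:E)%E.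
Proof.
move=> p0 t0 tT hphi s0; have [v -> mgf] := step_integral_mgf t0 tT hphi.
rewrite lee_fin => vs.
pose I := step_integral Z phi.
have mI : measurable_fun setT I by exact: measurable_step_integral.
pose K := sigma `^ p * p `^ p.
have K0 : 0 <= K by rewrite mulr_ge0 ?powR_ge0.
have me l : measurable_fun setT (fun w => (expR (l * I w))%:E).
  apply/measurable_EFinP; apply: measurableT_comp => //.
  exact: measurable_funM.
have e0 l w : (0 <= (expR (l * I w))%:E)%E by rewrite lee_fin expR_ge0.
apply: (@le_trans _ _ (\int[P]_w (K%:E * ((expR (sigma^-1 * I w))%:E +
    (expR (- sigma^-1 * I w))%:E)))%E).
  apply: le_integral_nonneg => w _; first by rewrite lee_fin powR_ge0.
  rewrite -EFinD -EFinM lee_fin.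
  have -> : `|step_integral Z phi w| = sigma * `|sigma^-1 * I w|.
    by rewrite normrM gtr0_norm ?invr_gt0// mulrA divff ?mul1r ?gt_eqF.
  rewrite powRM ?(ltW s0)// /K -mulrA ler_wpM2l ?powR_ge0//.
  apply: le_trans (powR_le_expR p0 (normr_ge0 _)) _.
  rewrite ler_wpM2l ?powR_ge0// mulNr.
  have [x0|x0] := lerP 0 (sigma^-1 * I w).
    by rewrite ger0_norm// lerDl expR_ge0.
  by rewrite ltr0_norm// lerDr expR_ge0.
rewrite ge0_integralZl_EFin//; last 2 first.
- by move=> w _; apply: adde_ge0.
- exact: emeasurable_funD.
rewrite ge0_integralD// !mgf -EFinD -EFinM lee_fin sqrrN.
have -> : p `^ p * 2 * expR 2^-1 * sigma `^ p =
    K * (expR 2^-1 + expR 2^-1) by rewrite /K; ring.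
rewrite ler_wpM2l// lerD// ler_expR;
rewrite -[leRHS]mul1r ler_wpM2r// exprVn mulrC ler_pdivrMr ?mul1r// exprn_gt0//.
Qed.

End step_moment.

(** * Passage to L^2 limits *)

Lemma cvge0_near_le (R : realType) (u : nat -> \bar R) (e : R) :
  u @ \oo --> 0%E -> 0 < e -> \forall n \near \oo, (u n <= e%:E)%E.
Proof.
move=> cu e0; have : nbhs 0%E [set x : \bar R | (x < e%:E)%E].
  by apply: open_nbhs_nbhs; split; [exact: open_ereal_lt_ereal | rewrite /= lte_fin].
move=> /cu h; near=> n; apply: ltW; near: n; exact: h.
Unshelve. all: by end_near. Qed.

Lemma near_le_cvge0 (R : realType) (u : nat -> \bar R) :
  (forall n, 0 <= u n)%E ->
  (forall e : R, 0 < e -> \forall n \near \oo, (u n <= e%:E)%E) ->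
  u @ \oo --> 0%E.
Proof.
move=> u0 ue; apply/fine_cvgP; split.
  apply: filterS (ue 1 ltr01) => n un.
  by rewrite ge0_fin_numE// (le_lt_trans un)// ltry.
apply/cvgrPdist_le => e e0; apply: filterS (ue e e0) => n un /=.
rewrite sub0r normrN ger0_norm ?fine_ge0// -lee_fin fineK//.
by rewrite ge0_fin_numE// (le_lt_trans un)// ltry.
Qed.

(* If |x| > 2 |y| then |x| <= 2 |y - x|.  The truncation at [M] makes it possible to
   pass to L^2 limits without extracting an almost surely convergent subsequence. *)
Lemma powR_trunc_le (R : realType) (p M x y : R) : 2 <= p -> 0 <= M ->
  `|x| <= M ->
  `|x| `^ p <= 2 `^ p * `|y| `^ p + 4 * M `^ (p - 2) * `|y - x| ^+ 2.
Proof.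
move=> p2 M0 xM; have p0 : 0 <= p by exact: le_trans p2.
have t1 : 0 <= 2 `^ p * `|y| `^ p by rewrite mulr_ge0 ?powR_ge0.
have t2 : 0 <= 4 * M `^ (p - 2) * `|y - x| ^+ 2.
  by rewrite !mulr_ge0 ?powR_ge0 ?sqr_ge0.
have [xy|yx] := lerP `|x| (2 * `|y|).
  apply: le_trans (_ : (2 * `|y|) `^ p <= _); last by rewrite powRM// lerDl.
  by apply: ge0_ler_powR; rewrite ?nnegrE ?mulr_ge0.
have x0 : 0 < `|x| by apply: le_lt_trans yx; rewrite mulr_ge0.
apply: le_trans (_ : 4 * M `^ (p - 2) * `|y - x| ^+ 2 <= _); last by rewrite lerDr.
have -> : `|x| `^ p = `|x| `^ (p - 2) * `|x| ^+ 2.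
  rewrite -powR_mulrn// -powRD ?subrK//.
  by apply/implyP => _; rewrite gt_eqF.
rewrite (_ : 4 * _ * _ = M `^ (p - 2) * (2 * `|y - x|) ^+ 2); last by ring.
apply: ler_pM; rewrite ?powR_ge0 ?sqr_ge0//.
  by apply: ge0_ler_powR; rewrite ?nnegrE ?subr_ge0.
rewrite lerXn2r ?nnegrE ?mulr_ge0//.
have := ler_distD y x 0; rewrite !subr0 distrC => H; lra.
Qed.

(** With [X] cut off at height [N], [powR_trunc_le] bounds the p-th moment by 2^p M plus an L^2
    error that vanishes as n grows while [N] is fixed. Monotone convergence in [N] removes the
    cut. *)
Lemma moment_L2_limit (d : measure_display) (U : measurableType d)
    (R : realType) (P : probability U R) (p M : R) (X : U -> R)
    (Xn : nat -> U -> R) :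
  2 <= p -> measurable_fun setT X -> (forall n, measurable_fun setT (Xn n)) ->
  (\int[P]_w (`|Xn n w - X w| ^+ 2)%:E)%E @[n --> \oo] --> 0%E ->
  (\forall n \near \oo, \int[P]_w (`|Xn n w| `^ p)%:E <= M%:E)%E ->
  (\int[P]_w (`|X w| `^ p)%:E <= (2 `^ p * M)%:E)%E.
Proof.
move=> p2 mX mXn cvX bX.
have p0 : 0 < p by apply: lt_le_trans p2.
have mpow (V : U -> R) : measurable_fun setT V ->
    measurable_fun setT (fun w => `|V w| `^ p).
  move=> mV; apply: (measurableT_comp (measurable_powR p)).
  exact: measurableT_comp.
pose h (N : nat) w := `|X w| `^ p * \1_[set w | `|X w| <= N%:R] w.
have mset (N : nat) : measurable [set w | `|X w| <= N%:R].
  rewrite -[X in measurable X]setTI; apply: measurable_fun_le => //.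
  exact: measurableT_comp.
have mh N : measurable_fun setT (fun w => (h N w)%:E).
  apply/measurable_EFinP; apply: measurable_funM; first exact: mpow.
  exact: measurable_indic.
have h0 N w : 0 <= h N w by rewrite mulr_ge0 ?powR_ge0.
have hb N : (\int[P]_w (h N w)%:E <= (2 `^ p * M)%:E)%E.
  apply/lee_addgt0Pr => e e0.
  (* The summand 1 keeps [k] positive even if the truncation coefficient is 0, so that [e / k] is a
     valid tolerance. *)
  pose k := 4 * N%:R `^ (p - 2) + 1 : R.
  have k0 : 0 < k by rewrite ltr_wpDl// mulr_ge0 ?powR_ge0.
  have ek0 : 0 < e / k by rewrite divr_gt0.
  near \oo => n.
  have E1 : (\int[P]_w (`|Xn n w| `^ p)%:E <= M%:E)%E by near: n.
  have E2 : (\int[P]_w (`|Xn n w - X w| ^+ 2)%:E <= (e / k)%:E)%E.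
    by near: n; exact: cvge0_near_le cvX ek0.
  apply: le_trans (_ : (\int[P]_w ((2 `^ p)%:E * (`|Xn n w| `^ p)%:E
     + k%:E * (`|Xn n w - X w| ^+ 2)%:E) <= _)%E).
    apply: le_integral_nonneg => w _; first by rewrite lee_fin.
    rewrite -!EFinM -EFinD lee_fin /h indicE.
    have [|_] := boolP (w \in _); last first.
      by rewrite mulr0 addr_ge0// mulr_ge0 ?powR_ge0 ?(ltW k0).
    move=> /set_mem /= XN; rewrite mulr1.
    apply: le_trans (powR_trunc_le (Xn n w) p2 _ XN) _ => //.
    by rewrite lerD2l ler_wpM2r ?lerDl.
  have m1 : measurable_fun setT (fun w => (`|Xn n w| `^ p)%:E).
    by apply/measurable_EFinP; exact: mpow.
  have m2 : measurable_fun setT (fun w => (`|Xn n w - X w| ^+ 2)%:E).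
    apply/measurable_EFinP; apply: measurable_funX.
    by apply: measurableT_comp => //; exact: measurable_funB.
  have n1 w : (0 <= (`|Xn n w| `^ p)%:E)%E by rewrite lee_fin powR_ge0.
  have n2 w : (0 <= (`|Xn n w - X w| ^+ 2)%:E)%E by rewrite lee_fin.
  have c1 : 0 <= 2 `^ p by exact: powR_ge0.
  have c2 := ltW k0.
  have km1 := measurable_funeM (2 `^ p)%:E m1.
  have km2 := measurable_funeM k%:E m2.
  rewrite ge0_integralD//; last by move=> w _; exact: mule_ge0.
  rewrite !ge0_integralZl_EFin//.
  rewrite EFinM; apply: leeD; first by rewrite lee_wpmul2l.
  apply: le_trans (_ : k%:E * (e / k)%:E <= _)%E.
    by rewrite lee_pmul2l.
  by rewrite -EFinM mulrCA divff ?mulr1// gt_eqF.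
have -> : (\int[P]_w (`|X w| `^ p)%:E = \int[P]_w limn (fun N => (h N w)%:E))%E.
  apply: eq_integral => w _; apply/esym/cvg_lim => //.
  apply: cvg_near_cst; near=> N; congr EFin.
  rewrite /h indicE mem_set ?mulr1//=.
  by near: N; exact: nbhs_infty_ger.
have cv : (\int[P]_w (h N w)%:E @[N --> \oo] -->
    \int[P]_w limn (fun N => (h N w)%:E))%E.
  apply: cvg_monotone_convergence => //.
    by move=> N w _; rewrite lee_fin.
  move=> w _ m n mn; rewrite lee_fin ler_wpM2l ?powR_ge0// !indicE.
  have [/set_mem /= Xm|//] := boolP (w \in [set w | `|X w| <= m%:R]).
  by rewrite mem_set//= (le_trans Xm)// ler_nat.
rewrite -(cvg_lim _ cv)//; apply: lime_le; first by apply/cvg_ex; eexists; exact: cv.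
by apply: nearW => N; exact: hb.
Unshelve. all: by end_near. Qed.

(** Pointwise (a + b + c)^2 <= 3 (a^2 + b^2 + c^2). The three terms are meant for two approximation
    errors and the quantity approximated; a vacant slot is filled by 0. *)
Lemma integral_sqr_sum3 (d : measure_display) (U : measurableType d)
    (R : realType) (mu : {measure set U -> \bar R}) (D : set U)
    (f1 f2 f3 f : U -> R) : measurable D ->
  measurable_fun D f1 -> measurable_fun D f2 -> measurable_fun D f3 ->
  (forall u, D u -> `|f u| <= `|f1 u| + `|f2 u| + `|f3 u|) ->
  (\int[mu]_(u in D) (f u ^+ 2)%:E <=
   3%:E * (\int[mu]_(u in D) (`|f1 u| ^+ 2)%:E +
     \int[mu]_(u in D) (`|f2 u| ^+ 2)%:E +
     \int[mu]_(u in D) (`|f3 u| ^+ 2)%:E))%E.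
Proof.
move=> mD mf1 mf2 mf3 ff.
have m2 (f' : U -> R) : measurable_fun D f' ->
    measurable_fun D (fun u => (`|f' u| ^+ 2)%:E).
  move=> mf'; apply/measurable_EFinP; apply: measurable_funX.
  exact: measurableT_comp.
have n2 (f' : U -> R) u : D u -> (0 <= (`|f' u| ^+ 2)%:E)%E.
  by move=> _; rewrite lee_fin.
have m12 := emeasurable_funD (m2 _ mf1) (m2 _ mf2).
have n12 u : D u -> (0 <= (`|f1 u| ^+ 2)%:E + (`|f2 u| ^+ 2)%:E)%E.
  by move=> _; rewrite adde_ge0.
have m123 := emeasurable_funD m12 (m2 _ mf3).
apply: (@le_trans _ _ (\int[mu]_(u in D) (3%:E *
    ((`|f1 u| ^+ 2)%:E + (`|f2 u| ^+ 2)%:E + (`|f3 u| ^+ 2)%:E)))%E); last first.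
  have n123 u : D u -> (0 <= (`|f1 u| ^+ 2)%:E + (`|f2 u| ^+ 2)%:E + (`|f3 u| ^+ 2)%:E)%E.
    by move=> Du; rewrite adde_ge0 ?n12.
  rewrite (ge0_integralZl_EFin _ mD n123 m123)//.
  rewrite (ge0_integralD _ mD n12 m12 (n2 f3) (m2 _ mf3)).
  by rewrite (ge0_integralD _ mD (n2 f1) (m2 _ mf1) (n2 f2) (m2 _ mf2)).
apply: le_integral_nonneg => u Du; first by rewrite lee_fin sqr_ge0.
rewrite -!EFinD -EFinM lee_fin -(real_normK (num_real (f u))).
move: (ff u Du) (normr_ge0 (f u)) (normr_ge0 (f1 u)) (normr_ge0 (f2 u)) (normr_ge0 (f3 u)).
move: `|f u| `|f1 u| `|f2 u| `|f3 u| => a b c e le_a a0 b0 c0 e0.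
apply: le_trans (_ : (b + c + e) ^+ 2 <= _).
  by rewrite lerXn2r ?nnegrE ?addr_ge0.
have := sqr_ge0 (b - c); have := sqr_ge0 (b - e); have := sqr_ge0 (c - e).
nra.
Qed.

Section wiener_increment.
Context (R : realType) (d : measure_display) (Omega : measurableType d).
Context (P : probability Omega R) (T : R) (Z : R -> {RV P >-> R}).
Hypothesis hZ : brownian_motion T Z.

Let neg (phi : seq (R * R * R)) : seq (R * R * R) := [seq (k.1, - k.2) | k <- phi].

Let step_fun_sub phi psi u :
  step_fun (phi ++ neg psi) u = step_fun phi u - step_fun psi u :> R.
Proof.
rewrite /step_fun big_cat big_map/= -sumrN; congr (_ + _).
by apply: eq_bigr => k _; rewrite mulNr.
Qed.

Let step_integral_sub phi psi w :
  step_integral Z (phi ++ neg psi) w = step_integral Z phi w - step_integral Z psi w.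
Proof.
rewrite /step_integral big_cat big_map/= -sumrN; congr (_ + _).
by apply: eq_bigr => k _; rewrite mulNr.
Qed.

Let measurable_step_fun D phi : measurable_fun D (step_fun phi : R -> R).
Proof.
by apply: measurable_sum => k; apply: measurable_funM.
Qed.

Let step_fun_eq0 s phi u : step_in s phi -> s < u -> step_fun phi u = 0 :> R.
Proof.
move=> hphi su; rewrite /step_fun big_seq big1// => k /hphi[_ _ ks].
by rewrite indicE memNset ?mulr0//= in_itv/= leNgt (le_lt_trans ks su) andbF.
Qed.

(** Concatenating [phi n] with the negated [psi n] gives a step function that approximates ft - fs
    1_[0, s] in L^2([0, t]) and whose integral approximates Xt - Xs in L^2(P). Its norm is
    eventually at most 2 W, whence the base of the last power. *)
Lemma wiener_incr_moment (p s t W : R) (ft fs : R -> R) (Xt Xs : {RV P >-> R}) :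
  2 <= p -> 0 <= s -> s <= t -> t <= T -> 0 < W ->
  measurable_fun `[0, t] ft -> measurable_fun `[0, s] fs ->
  is_wiener_integral Z t ft Xt -> is_wiener_integral Z s fs Xs ->
  (\int[lebesgue_measure]_(u in `[0%R, s]) (`|ft u - fs u| ^+ 2)%:E +
   \int[lebesgue_measure]_(u in `]s, t]) (`|ft u| ^+ 2)%:E <= (W ^+ 2)%:E)%E ->
  (\int[P]_w (`|Xt w - Xs w| `^ p)%:E <=
   (2 `^ p * (p `^ p * 2 * expR 2^-1 * (2 * W) `^ p))%:E)%E.
Proof.
move=> p2 s0 st tT W0 mft mfs [phi [phi_in phi_f phi_X]] [psi [psi_in psi_f psi_X]] hW.
have t0 := le_trans s0 st.
pose th n := phi n ++ neg (psi n).
have th_in n : step_in t (th n).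
  move=> k; rewrite mem_cat => /orP[/phi_in//|/mapP[k' /psi_in[a b c] ->]].
  by split => //=; exact: le_trans c st.
have mft1 : measurable_fun `[0, s] ft.
  by apply: measurable_funS mft => //; apply: subset_itvl; rewrite bnd_simp.
have mft2 : measurable_fun `]s, t] ft.
  by apply: measurable_funS mft => //; apply: subset_itvr; rewrite bnd_simp.
pose A n := (\int[lebesgue_measure]_(u in `[0%R, t]) (`|step_fun (phi n) u - ft u| ^+ 2)%:E)%E.
pose B n := (\int[lebesgue_measure]_(u in `[0%R, s]) (`|step_fun (psi n) u - fs u| ^+ 2)%:E)%E.
have mA n : measurable_fun `[0, t] (fun u => (`|step_fun (phi n) u - ft u| ^+ 2)%:E).
  apply/measurable_EFinP; apply: measurable_funX; apply: measurableT_comp => //.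
  exact: measurable_funB.
have AS n (D : set R) : measurable D -> D `<=` `[0, t] ->
   (\int[lebesgue_measure]_(u in D) (`|step_fun (phi n) u - ft u| ^+ 2)%:E <= A n)%E.
  move=> mD Dt; rewrite /A.
  exact: (@ge0_subset_integral _ _ _ lebesgue_measure _ _ mD (measurable_itv _) _ (mA n)).
have i0 (D : set R) (f : R -> R) :
    (0 <= \int[lebesgue_measure]_(u in D) (`|f u| ^+ 2)%:E)%E.
  by apply: integral_ge0 => u _; rewrite lee_fin.
(* [A n] is counted twice, once for [0, s] and once for ]s, t]; on the latter [psi n] contributes
   nothing. *)
have bound n : (\int[lebesgue_measure]_(u in `[0%R, t]) (step_fun (th n) u ^+ 2)%:E
    <= 3%:E * (A n + B n + A n + (W ^+ 2)%:E))%E.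
  have splt : `[0, t]%classic = `[0, s] `|` `]s, t] :> set R.
    by rewrite -itv_bndbnd_setU// bnd_simp.
  rewrite splt ge0_integral_setU//=; last 3 first.
  - rewrite -splt; apply/measurable_EFinP; apply: measurable_funX.
    exact: measurable_step_fun.
  - by move=> u _; rewrite lee_fin sqr_ge0.
  - apply/disj_setPS => u [/=]; rewrite !in_itv/= => /andP[_ us] /andP[su _].
    by move: us; rewrite leNgt su.
  have I1 := @integral_sqr_sum3 _ _ _ lebesgue_measure `[0, s]%classic (fun u => step_fun (phi n) u - ft u)
    (fun u => step_fun (psi n) u - fs u) (fun u => ft u - fs u) (step_fun (th n))
    (measurable_itv _) (measurable_funB (@measurable_step_fun _ _) mft1)
    (measurable_funB (@measurable_step_fun _ _) mfs) (measurable_funB mft1 mfs).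
  have I2 := @integral_sqr_sum3 _ _ _ lebesgue_measure `]s, t]%classic (fun u => step_fun (phi n) u - ft u)
    (fun u => ft u) (fun=> 0) (step_fun (th n))
    (measurable_itv _) (measurable_funB (@measurable_step_fun _ _) mft2) mft2
    (measurable_cst _).
  apply: le_trans (leeD (I1 _) (I2 _)) _.
  - move=> u _; rewrite step_fun_sub.
    rewrite (_ : _ - _ = step_fun (phi n) u - ft u - (step_fun (psi n) u - fs u)
      + (ft u - fs u)); last by ring.
    by apply: le_trans (ler_normD _ _) _; rewrite lerD2r; exact: ler_normB.
  - move=> u /=; rewrite in_itv/= => /andP[su _].
    rewrite step_fun_sub (step_fun_eq0 (psi_in n) su) subr0 normr0 addr0.
    by rewrite -{1}(subrK (ft u) (step_fun (phi n) u)) ler_normD.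
  rewrite normr0 expr0n/= integral0 adde0.
  rewrite -ge0_muleDr; last 2 first.
  - by apply: adde_ge0; first apply: adde_ge0; exact: i0.
  - by apply: adde_ge0; exact: i0.
  rewrite lee_wpmul2l// -/(B n).
  rewrite [leLHS](_ : _ = \int[lebesgue_measure]_(u in `[0%R, s]) (`|step_fun (phi n) u - ft u| ^+ 2)%:E +
     B n + \int[lebesgue_measure]_(u in `]s, t]) (`|step_fun (phi n) u - ft u| ^+ 2)%:E +
    (\int[lebesgue_measure]_(u in `[0%R, s]) (`|ft u - fs u| ^+ 2)%:E +
   \int[lebesgue_measure]_(u in `]s, t]) (`|ft u| ^+ 2)%:E))%E; last first.
    by rewrite addeACA !addeA.
  apply: leeD hW; apply: leeD; first apply: leeD => //.
    by apply: AS => //; apply: subset_itvl; rewrite bnd_simp.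
  by apply: AS => //; apply: subset_itvr; rewrite bnd_simp.
refine (@moment_L2_limit _ _ _ P p (p `^ p * 2 * expR 2^-1 * (2 * W) `^ p)
  (fun w => Xt w - Xs w) (fun n => step_integral Z (th n)) p2 _ _ _ _).
- exact: measurable_funB.
- by move=> n; exact: measurable_step_integral.
- apply: near_le_cvge0 => [n|e e0].
    by apply: integral_ge0 => w _; rewrite lee_fin.
  (* The tolerance is chosen so that 3 (e / 6 + e / 6) = e. *)
  have e6 : 0 < e / 6 by rewrite divr_gt0.
  near=> n.
  have Xn : (\int[P]_w (`|step_integral Z (phi n) w - Xt w| ^+ 2)%:E <= (e / 6)%:E)%E.
    by near: n; apply: cvge0_near_le e6; rewrite unlock in phi_X.
  have Yn : (\int[P]_w (`|step_integral Z (psi n) w - Xs w| ^+ 2)%:E <= (e / 6)%:E)%E.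
    by near: n; apply: cvge0_near_le e6; rewrite unlock in psi_X.
  under eq_integral do rewrite -[`| _ | ^+ 2]normrX [`|_ ^+ 2|]ger0_norm ?sqr_ge0//.
  have := @integral_sqr_sum3 _ _ _ P setT
    (fun w => step_integral Z (phi n) w - Xt w)
    (fun w => step_integral Z (psi n) w - Xs w) (fun=> 0)
    (fun w => step_integral Z (th n) w - (Xt w - Xs w)) measurableT.
  move=> /(_ (measurable_funB (measurable_step_integral _ _) (measurable_funPT Xt))).
  move=> /(_ (measurable_funB (measurable_step_integral _ _) (measurable_funPT Xs))).
  move=> /(_ (measurable_cst _) _) => H.
  apply: le_trans (H _) _.
    move=> w _; rewrite step_integral_sub normr0 addr0.
    rewrite (_ : _ - _ - _ = step_integral Z (phi n) w - Xt w -
      (step_integral Z (psi n) w - Xs w)); last by ring.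
    exact: ler_normB.
  rewrite normr0 expr0n/= integral0 adde0.
  apply: le_trans (_ : 3%:E * ((e / 6)%:E + (e / 6)%:E) <= _)%E.
    by rewrite lee_wpmul2l// leeD.
  by rewrite -EFinD -EFinM lee_fin le_eqVlt; apply/orP; left; apply/eqP; field.
(* With [A n] and [B n] at most W^2 / 9, the bound is 3 (3 W^2 / 9 + W^2) = (2 W)^2. *)
- have e0 : 0 < W ^+ 2 / 9 by rewrite divr_gt0// exprn_gt0.
  near=> n.
  apply: (step_integral_moment hZ _ t0 tT (th_in n)).
  + by apply: lt_le_trans p2.
  + by rewrite mulr_gt0.
  apply: le_trans (bound n) _.
  have An : (A n <= (W ^+ 2 / 9)%:E)%E by near: n; exact: cvge0_near_le phi_f e0.
  have Bn : (B n <= (W ^+ 2 / 9)%:E)%E by near: n; exact: cvge0_near_le psi_f e0.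
  apply: le_trans (_ : 3%:E * ((W ^+ 2 / 9)%:E + (W ^+ 2 / 9)%:E + (W ^+ 2 / 9)%:E
    + (W ^+ 2)%:E) <= _)%E.
    by rewrite lee_wpmul2l// leeD2r// !leeD.
  by rewrite -!EFinD -EFinM lee_fin le_eqVlt; apply/orP; left; apply/eqP; field.
Unshelve. all: by end_near. Qed.

End wiener_increment.

(** * The kernel *)

(** [f] may be unbounded near [a] and [b]. The fundamental theorem of calculus is applied on the
    compact intervals [a + 1/(n+1), b - 1/(n+1)], on which F stays in [0, M], and monotone
    convergence exhausts ]a, b[. *)
Lemma integral_le_primitive (R : realType) (a b M : R) (f F : R -> R) :
  (forall x, a < x < b -> is_derive x 1 F (f x)) ->
  (forall x, a < x < b -> {for x, continuous f}) ->
  (forall x, a < x < b -> 0 <= f x) ->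
  (forall x, a < x < b -> 0 <= F x <= M) -> 0 <= M ->
  (\int[lebesgue_measure]_(x in `]a, b[) (f x)%:E <= M%:E)%E.
Proof.
move=> dF cf f0 FM M0.
pose E (n : nat) := `[a + n.+1%:R^-1, b - n.+1%:R^-1]%classic.
have inE_ab n x : E n x -> a < x < b.
  have n0 : 0 < n.+1%:R^-1 :> R by rewrite invr_gt0 ltr0n.
  rewrite /E/= in_itv/= => /andP[ax xb]; move: n0 ax xb.
  by move: (n.+1%:R^-1) => e e0 ax xb; apply/andP; split; lra.
have UE : \bigcup_n E n = `]a, b[%classic.
  apply/seteqP; split => x /=; first by case=> n _ /inE_ab; rewrite in_itv.
  rewrite in_itv/= => /andP[ax xb].
  have e0 : 0 < Num.min (x - a) (b - x) by rewrite lt_min !subr_gt0 ax xb.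
  near \oo => n; exists n => //; rewrite /E/= in_itv/=.
  have : n.+1%:R^-1 < Num.min (x - a) (b - x).
    by near: n; exact: (near_infty_natSinv_lt (PosNum e0)).
  by rewrite lt_min; move: (n.+1%:R^-1) => e /andP[? ?]; apply/andP; split; lra.
have ndE : nondecreasing_seq E.
  move=> m n mn; rewrite subsetEset => x; rewrite /E/= !in_itv/= => /andP[mx xm].
  have : (n.+1%:R^-1 : R) <= m.+1%:R^-1 by rewrite lef_pV2 ?posrE// ler_nat.
  move: (n.+1%:R^-1) (m.+1%:R^-1) mx xm => e e' ? ? ?.
  by apply/andP; split; lra.
have cE n : {within E n, continuous f}.
  apply: continuous_in_subspaceT => x /set_mem/inE_ab; exact: cf.
have mE n : measurable_fun (E n) f.
  by apply: subspace_continuous_measurable_fun => //; exact: measurable_itv.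
rewrite -UE.
have cv : (\int[lebesgue_measure]_(x in E n) (f x)%:E @[n --> \oo] -->
    \int[lebesgue_measure]_(x in \bigcup_n E n) (f x)%:E)%E.
  apply: ge0_nondecreasing_set_cvg_integral => //.
  - by move=> n; exact: measurable_itv.
  - by move=> n; apply/measurable_EFinP; exact: mE.
  - by move=> n x Ex; rewrite lee_fin f0//; exact: inE_ab Ex.
rewrite -(cvg_lim _ cv)//; apply: lime_le; first by apply/cvg_ex; eexists; exact: cv.
apply: nearW => n; rewrite /E.
have [lt_n|] := ltrP (a + n.+1%:R^-1) (b - n.+1%:R^-1); last first.
  rewrite le_eqVlt => /predU1P[->|gt_n].
    by rewrite set_itv1 integral_set1.
  by rewrite set_itv_ge ?integral_set0// bnd_simp -ltNge.
have din x : x \in `[a + n.+1%:R^-1, b - n.+1%:R^-1] -> a < x < b.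
  by move=> xi; exact: (@inE_ab n).
have xl : a < a + n.+1%:R^-1 < b by apply: din; rewrite in_itv/= lexx ltW.
have xr : a < b - n.+1%:R^-1 < b by apply: din; rewrite in_itv/= lexx ltW.
have cF x : a < x < b -> {for x, continuous F}.
  move=> xab; apply: differentiable_continuous; apply/derivable1_diffP.
  by have [] := dF x xab.
rewrite (@continuous_FTC2 _ f F _ _ lt_n (cE n))//; last 2 first.
- split.
  + move=> x xi; have [] // := dF x _; apply: din.
    exact: subset_itv_oo_cc.
  + by apply: cvg_at_right_filter; exact: cF.
  + by apply: cvg_at_left_filter; exact: cF.
- move=> x xi; rewrite derive1E.
  by have [_] := dF x (din x (subset_itv_oo_cc xi)).
rewrite -EFinB lee_fin.
have /andP[F0 _] := FM _ xl; have /andP[_ F1] := FM _ xr; lra.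
Unshelve. all: by end_near. Qed.

Lemma continuous_powR_gt0 (R : realType) (c x : R) : 0 < x ->
  {for x, continuous (fun y : R => y `^ c)}.
Proof.
move=> x0; apply: differentiable_continuous; apply/derivable1_diffP.
by apply: derivable_powR; rewrite in_itv/= x0.
Qed.

Lemma integral_powR_le (R : realType) (c b : R) : -1 < c -> 0 < b ->
  (\int[lebesgue_measure]_(u in `]0%R, b[) (u `^ c)%:E <= (b `^ (c + 1) / (c + 1))%:E)%E.
Proof.
move=> c1 b0; have c0 : 0 < c + 1 by rewrite -ltrBlDr sub0r.
apply: (@integral_le_primitive _ _ _ _ (fun u => u `^ c)
  (fun u => u `^ (c + 1) / (c + 1))).
- move=> x /andP[x0 _]; have dp := is_derive1_powR (c + 1) x0.
  apply: is_derive_eq; rewrite scaler0 add0r /GRing.scale/= addrK mulrA mulVf ?mul1r//.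
  by rewrite gt_eqF.
- by move=> x /andP[x0 _]; exact: continuous_powR_gt0.
- by move=> x _; exact: powR_ge0.
- move=> x /andP[x0 xb]; rewrite divr_ge0 ?powR_ge0 ?(ltW c0)//= ler_pM2r ?invr_gt0//.
  by rewrite ge0_ler_powR ?nnegrE ?(ltW x0) ?(ltW b0) ?(ltW c0) ?(ltW xb).
- by rewrite divr_ge0 ?powR_ge0 ?(ltW c0).
Qed.

Lemma integral_powRB_le (R : realType) (c s t : R) : -1 < c -> s < t ->
  (\int[lebesgue_measure]_(u in `]s, t[) ((t - u) `^ c)%:E
    <= ((t - s) `^ (c + 1) / (c + 1))%:E)%E.
Proof.
move=> c1 st; have c0 : 0 < c + 1 by rewrite -ltrBlDr sub0r.
have dg (x : R) : is_derive x 1 (fun u => t - u) (-1).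
  exact: (is_derive_eq (is_deriveB (is_derive_cst t x 1) (is_derive_id x 1)) (sub0r 1)).
have M0 : 0 <= (t - s) `^ (c + 1) / (c + 1) by rewrite divr_ge0 ?powR_ge0 ?(ltW c0).
(* The primitive is shifted by a constant so as to vanish at [s]; this keeps it nonnegative. *)
apply: (@integral_le_primitive _ _ _ _ (fun u => (t - u) `^ c)
  (fun u => (t - s) `^ (c + 1) / (c + 1) - (t - u) `^ (c + 1) / (c + 1))) => //.
- move=> x /andP[_ xt]; have tx0 : 0 < t - x by rewrite subr_gt0.
  have dp := is_derive1_powR (c + 1) tx0.
  have dc := @is_derive1_comp _ (fun y : R => y `^ (c + 1)) (fun u => t - u) x _ _ dp (dg x).
  have d2 := is_deriveB (is_derive_cst ((t - s) `^ (c + 1) / (c + 1)) x 1)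
    (is_deriveM dc (is_derive_cst ((c + 1)^-1) x 1)).
  apply: (is_derive_eq d2); rewrite scaler0 !add0r addrK /GRing.scale/=.
  by rewrite mulrN1 mulrN opprK mulrA mulVf ?mul1r// gt_eqF.
- move=> x /andP[_ xt]; have tx0 : 0 < t - x by rewrite subr_gt0.
  have [dd _] := @is_derive1_comp _ (fun y : R => y `^ c) (fun u => t - u) x _ _
    (is_derive1_powR c tx0) (dg x).
  by apply: differentiable_continuous; apply/derivable1_diffP.
- by move=> x _; exact: powR_ge0.
- move=> x /andP[sx xt]; rewrite subr_ge0 lerBlDr lerDl divr_ge0 ?powR_ge0 ?(ltW c0)//.
  rewrite ler_pM2r ?invr_gt0// andbT.
  by rewrite ge0_ler_powR ?nnegrE ?subr_ge0 ?(ltW c0) ?(ltW xt) ?(ltW st)// lerD2l lerN2 ltW.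
Qed.

(** For c >= 0 monotonicity suffices; for c < 0 the worst case is u = t / 2. The exponent |c| gives
    one constant for both signs. *)
Lemma powR_half_le (R : realType) (u t c : R) : 0 < t -> t / 2 <= u -> u <= t ->
  u `^ c <= 2 `^ `|c| * t `^ c.
Proof.
move=> t0 tu ut; have u0 : 0 < u by apply: lt_le_trans tu; rewrite divr_gt0.
have [c0|c0] := lerP 0 c.
  apply: (@le_trans _ _ (1 * t `^ c)).
    by rewrite mul1r ge0_ler_powR ?nnegrE ?(ltW u0) ?(ltW t0).
  rewrite ler_wpM2r ?powR_ge0// ger0_norm//.
  by rewrite -{1}(powRr0 2) ler_powR// ler1n.
rewrite ltr0_norm//; move: c0; rewrite -oppr_gt0 -[c in u `^ c]opprK -[c in t `^ c]opprK.
move: (- c) => e e0; rewrite !powRN -invf_div lef_pV2 ?posrE ?divr_gt0 ?powR_gt0//.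
have -> : t `^ e / 2 `^ e = (t / 2) `^ e.
  by rewrite powRM ?(ltW t0)// -[2^-1]powR_inv1// -powRrM mulN1r powRN.
by rewrite ge0_ler_powR ?nnegrE ?(ltW u0) ?(ltW e0) ?divr_ge0 ?(ltW t0).
Qed.

(** On each half of [0, t] one of the factors u^b and (t - u)^c is bounded by a multiple of its
    value at scale [t], and the other is integrable. Both halves give a multiple of t^(a + b) (t -
    s)^(c + 1); the power t^(a + b) then goes into the exponent if a + b < 0 and into the constant
    [E] otherwise. *)
Lemma integral_beta_kernel_le (R : realType) (a b c T : R) :
  -1 < b -> -1 < c -> 0 < T ->
  exists2 K : R, 0 <= K & forall s t : R, 0 <= s -> s < t -> t <= T ->
    (\int[lebesgue_measure]_(u in `]s, t[) (t `^ a * u `^ b * (t - u) `^ c)%:E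
     <= (K * (t - s) `^ ((if a + b < 0 then a + b + c else c) + 1))%:E)%E.
Proof.
move=> b1 c1 T0.
have b0 : 0 < b + 1 by rewrite -ltrBlDr sub0r.
have c0 : 0 < c + 1 by rewrite -ltrBlDr sub0r.
pose Db := 2 `^ `|b|; pose Dc := 2 `^ `|c|.
pose L := Db / (c + 1) + Dc * 2 `^ (c + 1) / (b + 1).
have L0 : 0 <= L by rewrite addr_ge0 ?divr_ge0 ?mulr_ge0 ?powR_ge0 ?(ltW b0) ?(ltW c0).
pose E := if a + b < 0 then 1 else T `^ (a + b).
have E0 : 0 <= E by rewrite /E; case: ifP => _; rewrite ?powR_ge0.
exists (L * E) => [|s t s0 st tT]; first exact: mulr_ge0.
have t0 : 0 < t by exact: le_lt_trans s0 st.
have ts0 : 0 < t - s by rewrite subr_gt0.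
pose A := t `^ (a + b) * Db.
(* The part u < t / 2 is present only if s < t / 2, hence the value 0 otherwise. *)
pose B := if s < t / 2 then t `^ (a + c) * Dc else 0.
have A0 : 0 <= A by rewrite mulr_ge0 ?powR_ge0.
have B0 : 0 <= B by rewrite /B; case: ifP => _; rewrite ?mulr_ge0 ?powR_ge0.
have tn0 e : (e == 0) ==> (t != 0) by apply/implyP => _; rewrite gt_eqF.
have pt u : s < u -> u < t ->
    t `^ a * u `^ b * (t - u) `^ c <= A * (t - u) `^ c + B * u `^ b.
  move=> su ut; have u0 : 0 < u by exact: le_lt_trans su.
  have [tu|ut2] := lerP (t / 2) u.
    rewrite ler_wpDr ?mulr_ge0 ?powR_ge0// ler_wpM2r ?powR_ge0//.
    rewrite /A powRD ?tn0// -mulrA ler_wpM2l ?powR_ge0// mulrC.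
    by apply: powR_half_le => //; exact: ltW.
  rewrite ler_wpDl ?mulr_ge0 ?powR_ge0// /B (lt_trans su ut2).
  rewrite mulrAC ler_wpM2r ?powR_ge0// powRD ?tn0// -mulrA ler_wpM2l ?powR_ge0// mulrC.
  by apply: powR_half_le => //; lra.
have mb : measurable_fun `]s, t[ (fun u : R => (u `^ b)%:E).
  by apply/measurable_EFinP; apply: measurable_funTS; exact: measurable_powR.
have mc : measurable_fun `]s, t[ (fun u : R => ((t - u) `^ c)%:E).
  apply/measurable_EFinP; apply: measurable_funTS.
  by apply: (measurableT_comp (measurable_powR c)); exact: measurable_funB.
have nb (u : R) : (0 <= (u `^ b)%:E)%E by rewrite lee_fin powR_ge0.
have nc (u : R) : (0 <= ((t - u) `^ c)%:E)%E by rewrite lee_fin powR_ge0.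
apply: (@le_trans _ _ (\int[lebesgue_measure]_(u in `]s, t[)
    (A%:E * ((t - u) `^ c)%:E + B%:E * (u `^ b)%:E))%E).
  apply: le_integral_nonneg => u; rewrite /= in_itv/= => /andP[su ut].
    by rewrite lee_fin !mulr_ge0 ?powR_ge0.
  by rewrite -!EFinM -EFinD lee_fin pt.
have mAc := measurable_funeM A%:E mc.
have mBb := measurable_funeM B%:E mb.
rewrite ge0_integralD//; last 2 first.
- by move=> u _; apply: mule_ge0.
- by move=> u _; apply: mule_ge0.
rewrite !ge0_integralZl_EFin//.
apply: (@le_trans _ _ ((A * ((t - s) `^ (c + 1) / (c + 1)) +
    B * (t `^ (b + 1) / (b + 1)))%:E)).
  rewrite EFinD !EFinM; apply: leeD; apply: lee_wpmul2l => //.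
    exact: integral_powRB_le.
  apply: le_trans (integral_powR_le b1 t0).
  have mb' : measurable_fun `]0, t[ (fun u : R => (u `^ b)%:E).
    by apply/measurable_EFinP; apply: measurable_funTS; exact: measurable_powR.
  apply: (@ge0_subset_integral _ _ _ lebesgue_measure _ _ (measurable_itv _)
    (measurable_itv _) _ mb') => //.
  by apply: subset_itvr; rewrite bnd_simp.
rewrite lee_fin.
(* When s < t / 2, one has t <= 2 (t - s); this turns t^(c + 1) into (t - s)^(c + 1) and produces
   the factor 2^(c + 1). *)
have BL : B * t `^ (b + 1) <= t `^ (a + b) * (Dc * 2 `^ (c + 1)) * (t - s) `^ (c + 1).
  rewrite /B; case: ifP => [st2|_]; last first.
    by rewrite mul0r !mulr_ge0 ?powR_ge0.
  have -> : t `^ (a + c) * Dc * t `^ (b + 1) = t `^ (a + b) * Dc * t `^ (c + 1).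
    by rewrite ![_ * Dc]mulrC -!mulrA -!powRD ?tn0//; congr (_ * _ `^ _); ring.
  rewrite -!mulrA !ler_wpM2l ?powR_ge0// -powRM// ?(ltW ts0)//.
  by rewrite ge0_ler_powR ?nnegrE ?mulr_ge0 ?(ltW t0) ?(ltW ts0) ?(ltW c0)//; lra.
have step1 : A * ((t - s) `^ (c + 1) / (c + 1)) + B * (t `^ (b + 1) / (b + 1)) <=
    L * (t `^ (a + b) * (t - s) `^ (c + 1)).
  rewrite /L mulrDl; apply: lerD.
    by rewrite le_eqVlt; apply/orP; left; apply/eqP; rewrite /A; ring.
  rewrite mulrA ler_pdivrMr// (le_trans BL)// le_eqVlt; apply/orP; left; apply/eqP.
  by field; rewrite gt_eqF.
apply: le_trans step1 _; rewrite -mulrA ler_wpM2l// /E.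
case: ifP => [ab0|/negbT]; last first.
  rewrite -leNgt => ab0; rewrite ler_wpM2r ?powR_ge0//.
  by rewrite ge0_ler_powR ?nnegrE ?(ltW t0) ?(ltW T0).
rewrite mul1r -addrA [(t - s) `^ (a + b + _)]powRD; last by apply/implyP => _; rewrite gt_eqF.
rewrite ler_wpM2r ?powR_ge0//.
move: ab0; rewrite -oppr_gt0 -[in X in _ -> X](opprK (a + b)).
move: (- (a + b)) => e e0; rewrite !powRN lef_pV2 ?posrE ?powR_gt0//.
by rewrite ge0_ler_powR ?nnegrE ?(ltW t0) ?(ltW ts0) ?(ltW e0)// gerBl.
Qed.

Lemma sqr_powR (R : realType) (x a : R) : (x `^ a) ^+ 2 = x `^ (2 * a).
Proof. by rewrite -powR_mulrn ?powR_ge0// -powRrM mulrC. Qed.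

Section kernel_increment.
Context (R : realType) (T : R) (hT : 0 < T) (g : R -> R -> R).
Hypothesis hg : measurable_fun
  [set tu : R * R | 0 < tu.2 /\ tu.2 < tu.1 /\ tu.1 <= T]
  (fun tu : R * R => g tu.1 tu.2).

(** Joint measurability is given on the triangle 0 < u < t <= T; its section at [t] is ]0, t[, and
    adding the two endpoints preserves measurability. *)
Lemma measurable_kernel (t : R) : t <= T -> measurable_fun `[0, t] (g t).
Proof.
move=> tT.
have mle (f1 f2 : R * R -> R) : measurable_fun setT f1 -> measurable_fun setT f2 ->
    measurable [set x | f1 x <= f2 x].
  by move=> m1 m2; rewrite -[X in measurable X]setTI; exact: measurable_fun_le.
have mlt (f1 f2 : R * R -> R) : measurable_fun setT f1 -> measurable_fun setT f2 ->
    measurable [set x | f1 x < f2 x].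
  move=> m1 m2; rewrite (_ : [set _ | _] = ~` [set x | f2 x <= f1 x]).
    by apply: measurableC; exact: mle.
  by apply/seteqP; split => x /=; rewrite ltNge => /negP.
have mD : measurable [set tu : R * R | 0 < tu.2 /\ tu.2 < tu.1 /\ tu.1 <= T].
  rewrite (_ : [set _ | _] = [set tu : R * R | 0 < tu.2] `&`
     ([set tu : R * R | tu.2 < tu.1] `&` [set tu : R * R | tu.1 <= T])) //.
  by apply: measurableI; [exact: mlt | apply: measurableI; [exact: mlt | exact: mle]].
apply: (@measurable_fun_itv_cc _ _ _ false true).
apply: (@measurable_comp _ _ _ _ _ _ _ (fun tu : R * R => g tu.1 tu.2) _
  (fun u => (t, u)) mD _ hg); last by apply: measurable_funTS; exact: pair1_measurable.
by move=> _ [u /= + <-]; rewrite in_itv/= => /andP[].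
Qed.

Variables alpha beta gamma delta : R.
Hypotheses (hbeta : - 2^-1 < beta) (hgamma : - 2^-1 < gamma).
Hypothesis B1 : exists C : R, forall t u : R, 0 < u -> u < t -> t <= T ->
  `|g t u| <= C * t `^ alpha * u `^ beta * (t - u) `^ gamma.
Hypothesis B2 : exists h : R -> R -> R -> R,
  (forall t s u : R, 0 < u -> u < s -> s < t -> t <= T ->
     `|g t u - g s u| <= `|t - s| `^ delta * h t s u) /\
  (ereal_sup
     [set (\int[lebesgue_measure]_(u in `[0%R, st.1])
             (`|h st.2 st.1 u| ^+ 2)%:E)%E
      | st in [set st : R * R | 0 < st.1 /\ st.1 < st.2 /\ st.2 <= T]%R]
   < +oo)%E.

(** Squaring (B1) doubles the exponents: those of u and t - u exceed -1, which makes the beta-type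
    integral finite, and the sign of 2 alpha + 2 beta decides between the two cases of [kappa]. *)
Lemma kernel_tail_le : exists2 K : R, 0 <= K &
  forall s t : R, 0 <= s -> s < t -> t <= T ->
    (\int[lebesgue_measure]_(u in `]s, t]) (`|g t u| ^+ 2)%:E
     <= (K * (t - s) `^ (2 * (kappa alpha beta gamma + 2^-1)))%:E)%E.
Proof.
have [C hC] := B1.
have b1 : -1 < 2 * beta by rewrite -ltr_pdivrMl// mulrN1.
have c1 : -1 < 2 * gamma by rewrite -ltr_pdivrMl// mulrN1.
have [K K0 hK] := integral_beta_kernel_le (2 * alpha) b1 c1 hT.
exists (C ^+ 2 * K) => [|s t s0 st tT]; first by rewrite mulr_ge0 ?sqr_ge0.
have mg : measurable_fun `]s, t[ (fun u => (`|g t u| ^+ 2)%:E).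
  apply/measurable_EFinP; apply: measurable_funX; apply: measurableT_comp => //.
  apply: measurable_funS (measurable_kernel tT) => //.
  by apply: subset_itv; rewrite bnd_simp.
(* (B1) says nothing at u = t, so this endpoint is dropped. *)
rewrite (@integral_itv_bndoo _ s t _ false false mg).
pose k u := t `^ (2 * alpha) * u `^ (2 * beta) * (t - u) `^ (2 * gamma).
have k0 u : 0 <= k u by rewrite !mulr_ge0 ?powR_ge0.
have mk : measurable_fun `]s, t[ (fun u => (k u)%:E).
  apply/measurable_EFinP; apply: measurable_funTS.
  apply: measurable_funM; first by apply: measurable_funM => //; exact: measurable_powR.
  by apply: (measurableT_comp (measurable_powR _)); exact: measurable_funB.
apply: (@le_trans _ _ (\int[lebesgue_measure]_(u in `]s, t[) ((C ^+ 2)%:E * (k u)%:E))%E).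
  apply: le_integral_nonneg => u; first by rewrite lee_fin sqr_ge0.
  rewrite /= in_itv/= => /andP[su ut]; have u0 := le_lt_trans s0 su.
  have H := hC t u u0 ut tT.
  rewrite -EFinM lee_fin.
  have -> : C ^+ 2 * k u = (C * t `^ alpha * u `^ beta * (t - u) `^ gamma) ^+ 2.
    by rewrite /k !exprMn !sqr_powR !mulrA.
  by rewrite lerXn2r ?nnegrE// (le_trans _ H).
rewrite ge0_integralZl_EFin//; last 2 first.
- by move=> u _; rewrite lee_fin.
- exact: sqr_ge0.
rewrite -mulrA [leRHS]EFinM lee_wpmul2l ?lee_fin ?sqr_ge0//.
apply: le_trans (hK s t s0 st tT) _; rewrite lee_fin ler_wpM2l//.
rewrite le_eqVlt; apply/orP; left; apply/eqP; congr (_ `^ _).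
rewrite /kappa -mulrDr pmulr_rlt0//.
by case: ifP => _; field.
Qed.

(** [h] may fail to be measurable, so the factor (t - s)^(2 delta) is divided out of the measurable
    kernel increment instead of being pulled out of an integral of [h]. *)
Lemma kernel_diff_le : exists2 K : R, 0 <= K &
  forall s t : R, 0 <= s -> s < t -> t <= T ->
    (\int[lebesgue_measure]_(u in `[0%R, s]) (`|g t u - g s u| ^+ 2)%:E
     <= (K * (t - s) `^ (2 * delta))%:E)%E.
Proof.
have [h [hh]] := B2; set S := ereal_sup _ => Soo.
have SH : (S <= `|fine S|%:E)%E.
  by case: S Soo => [r|//|] _ /=; rewrite ?lee_fin ?ler_norm ?leNye.
exists `|fine S| => // s t s0 st tT.
move: s0; rewrite le_eqVlt => /predU1P[<-|s0].
  by rewrite set_itv1 integral_set1 lee_fin mulr_ge0 ?powR_ge0.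
have x0 : 0 < (t - s) `^ (2 * delta) by rewrite powR_gt0// subr_gt0.
set x := _ `^ _ in x0 *.
pose q u := x^-1 * `|g t u - g s u| ^+ 2.
have mg : measurable_fun `[0, s] (fun u => `|g t u - g s u| ^+ 2).
  apply: measurable_funX; apply: measurableT_comp => //; apply: measurable_funB.
    apply: measurable_funS (measurable_kernel tT) => //.
    by apply: subset_itvl; rewrite bnd_simp ltW.
  by apply: measurable_kernel; rewrite (le_trans (ltW st)).
have mq : measurable_fun `[0, s] (fun u => (q u)%:E).
  by apply/measurable_EFinP; exact: measurable_funM.
have mq' : measurable_fun `]0, s[ (fun u => (q u)%:E).
  by apply: measurable_funS mq => //; apply: subset_itv; rewrite bnd_simp.
have q0 u : 0 <= q u by rewrite mulr_ge0 ?invr_ge0 ?(ltW x0).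
have -> : (\int[lebesgue_measure]_(u in `[0%R, s]) (`|g t u - g s u| ^+ 2)%:E =
   \int[lebesgue_measure]_(u in `[0%R, s]) (x%:E * (q u)%:E))%E.
  apply: eq_integral => u _; rewrite -EFinM /q mulrA divff ?mul1r// gt_eqF//.
rewrite ge0_integralZl_EFin ?(ltW x0)//; last by move=> u _; rewrite lee_fin.
rewrite mulrC [leRHS]EFinM lee_wpmul2l ?lee_fin ?(ltW x0)//.
rewrite (@integral_itv_bndoo _ 0 s _ true false mq').
apply: le_trans SH; apply: le_trans (_ :
  \int[lebesgue_measure]_(u in `[0%R, s]) (`|h t s u| ^+ 2)%:E <= _)%E; last first.
  by apply: ereal_sup_ubound; exists (s, t).
(* The bound q <= |h|^2 is available only for 0 < u < s, while the supremum integrates over [0, s];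
   both integrands are extended by 0 before they are compared. *)
rewrite integral_mkcond [leRHS]integral_mkcond.
apply: le_integral_nonneg => u _.
  by apply: erestrict_ge0 => v _; rewrite lee_fin.
rewrite !patchE; case: ifPn => [/set_mem|_]; last first.
  by case: ifP; rewrite ?lee_fin.
rewrite /= in_itv/= => /andP[u0 us]; rewrite mem_set ?lee_fin; last first.
  by rewrite /= in_itv/= !ltW.
have H := hh t s u u0 us st tT.
rewrite /q mulrC ler_pdivrMr// /x.
have -> : (t - s) `^ (2 * delta) = (`|t - s| `^ delta) ^+ 2.
  by rewrite sqr_powR gtr0_norm// subr_gt0.
rewrite mulrC -exprMn lerXn2r ?nnegrE ?mulr_ge0 ?powR_ge0//.
by apply: le_trans H _; rewrite ler_wpM2l ?powR_ge0 ?ler_norm.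
Qed.

End kernel_increment.

(** * Dyadic chaining *)

Lemma geometric_increments_cvg (R : realType) (z : nat -> R) (K r : R) :
  0 <= K -> 0 < r < 1 -> (forall n, `|z n.+1 - z n| <= K * r ^+ n.+1) ->
  exists2 l : R, z @ \oo --> l & forall n, `|l - z n| <= K / (1 - r) * r ^+ n.
Proof.
move=> K0 /andP[r0 r1] hz; set c := K / (1 - r).
have r1' : 0 < 1 - r by rewrite subr_gt0.
have cE : c * (1 - r) = K by rewrite /c divfK// gt_eqF.
have c0 : 0 <= c by rewrite divr_ge0// ltW.
have step n : `|z n.+1 - z n| <= c * r ^+ n - c * r ^+ n.+1.
  apply: le_trans (hz n) _.
  have -> : c * r ^+ n - c * r ^+ n.+1 = K * r ^+ n by rewrite exprS -cE; ring.
  by rewrite ler_wpM2l// exprS ler_piMl ?exprn_ge0 ?(ltW r0) ?(ltW r1).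
(* [v] increases, [w] decreases, and both have the limit of [z]. *)
pose w n := z n + c * r ^+ n; pose v n := z n - c * r ^+ n.
have wni : nonincreasing_seq w.
  apply/nonincreasing_seqP => n; have := step n; rewrite ler_norml => /andP[_ H].
  by rewrite /w; lra.
have vnd : nondecreasing_seq v.
  apply/nondecreasing_seqP => n; have := step n; rewrite ler_norml => /andP[H _].
  by rewrite /v; lra.
have vw n m : v n <= w m.
  apply: (@le_trans _ _ (v (maxn n m))); first by apply: vnd; exact: leq_maxl.
  apply: (@le_trans _ _ (w (maxn n m))); last by apply: wni; exact: leq_maxr.
  have : 0 <= c * r ^+ maxn n m by rewrite mulr_ge0 ?exprn_ge0 ?(ltW r0).
  by rewrite /v /w => ?; lra.
have cw : cvgn w.
  apply: nonincreasing_is_cvgn => //; exists (v 0) => _ [n _ <-]; exact: vw.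
exists (limn w).
  have -> : z = w - (fun n => c * r ^+ n) by apply/funext => n; rewrite /w /= addrK.
  rewrite -[limn w]subr0; apply: cvgB => //.
  rewrite -[0](mulr0 c); apply: cvgM; first exact: cvg_cst.
  by apply: cvg_expr; rewrite ger0_norm// ltW.
move=> n; have H1 := nonincreasing_cvgn_ge wni cw n.
have H2 : v n <= limn w by apply: limr_ge => //; apply: nearW => m; exact: vw.
by rewrite ler_norml; move: H1 H2; rewrite /v /w => ? ?; apply/andP; split; lra.
Qed.

Lemma expr_powR (R : realType) (x a : R) (n : nat) : 0 <= x ->
  (x `^ a) ^+ n = (x ^+ n) `^ a.
Proof. by move=> x0; rewrite -(powR_mulrn n (powR_ge0 x a)) -(powR_mulrn n x0) powRAC. Qed.

Lemma powR2N_lt1 (R : realType) (a : R) : 0 < a -> 2 `^ (- a) < 1.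
Proof.
move=> a0; rewrite powRN invf_lt1 ?powR_gt0//; have := @gt0_ltr_powR R a a0 1 2.
by rewrite powR1 !nnegrE; apply; rewrite ?ltr1n.
Qed.

(** For the indices of one point at two consecutive levels: its dyadic floor stays or moves up by
    one finer mesh. *)
Lemma nat_between_double (i j : nat) : (2 * j < i.+1)%N -> (i < 2 * j.+1)%N ->
  i = (2 * j)%N \/ i = (2 * j).+1.
Proof. lia. Qed.

(** For the indices of two points at most one mesh apart. *)
Lemma nat_between_succ (i j : nat) : (j < i.+1)%N -> (i < j.+2)%N ->
  i = j \/ i = j.+1.
Proof. lia. Qed.

Section dyadic_chaining.
Context (R : realType) (T : R) (hT : 0 < T).

Definition dyadic_point (n k : nat) : R := T * (k%:R / 2 ^+ n).

Definition dyadic_index (n : nat) (t : R) : nat := Num.truncn (t / T * 2 ^+ n).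

Definition dyadic_floor (n : nat) (t : R) : R := dyadic_point n (dyadic_index n t).

Let p2 n : 0 < 2 ^+ n :> R. Proof. by rewrite exprn_gt0. Qed.

Lemma dyadic_index_itv n t : 0 <= t ->
  (dyadic_index n t)%:R <= t / T * 2 ^+ n < (dyadic_index n t).+1%:R.
Proof.
by move=> t0; apply: truncn_itv; rewrite mulr_ge0 ?divr_ge0 ?(ltW hT) ?(ltW (p2 n)).
Qed.

Lemma dyadic_index_le n t : 0 <= t <= T -> (dyadic_index n t <= 2 ^ n)%N.
Proof.
move=> /andP[t0 tT]; have /andP[H _] := dyadic_index_itv n t0.
rewrite -(ler_nat R) (le_trans H)// natrX ler_piMl ?(ltW (p2 n))//.
by rewrite ler_pdivrMr// mul1r.
Qed.

Lemma dyadic_floor_itv n t : 0 <= t ->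
  dyadic_floor n t <= t /\ t - dyadic_floor n t <= T / 2 ^+ n.
Proof.
move=> t0; have /andP[H1 H2] := dyadic_index_itv n t0.
have tE : t = T * ((t / T * 2 ^+ n) / 2 ^+ n).
  by rewrite mulfK ?gt_eqF// mulrC divfK// gt_eqF.
rewrite /dyadic_floor /dyadic_point; split.
  by rewrite {2}tE ler_pM2l// ler_pM2r ?invr_gt0.
rewrite {1}tE -mulrBr ler_pM2l// -mulrBl -[leRHS]mul1r ler_pM2r ?invr_gt0//.
by rewrite lerBlDl natr1 ltW.
Qed.

Lemma dyadic_floor_ge0 n t : 0 <= dyadic_floor n t.
Proof.
by rewrite mulr_ge0 ?divr_ge0 ?(ltW hT) ?(ltW (p2 n)).
Qed.

(** For s < t let [n] be the level with 2^-(n+1) < (t - s) / T <= 2^-n. The level-n floors of [s]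
    and [t] are equal or adjacent, and [z] at either point differs from [y] at its floor by a
    geometric tail. As [y] is controlled only at dyadic points, [z] is the limit along the floors
    and may differ from [y]. *)
Lemma dyadic_holder (y : R -> R) (lambda K : R) : 0 < lambda -> 0 <= K ->
  (forall n k, (k < 2 ^ n)%N -> `|y (dyadic_point n k.+1) - y (dyadic_point n k)|
     <= K * (2 `^ (- lambda)) ^+ n) ->
  exists2 z : R -> R,
    forall t, 0 <= t <= T -> y (dyadic_floor n t) @[n --> \oo] --> z t &
    holder_on `[0, T] lambda z.
Proof.
move=> l0 K0; set r := 2 `^ (- lambda) => hy.
have r0 : 0 < r by rewrite powR_gt0.
have r1 : r < 1 by exact: powR2N_lt1.
have chain t : 0 <= t <= T -> exists2 l : R, y (dyadic_floor n t) @[n --> \oo] --> l &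
    forall n, `|l - y (dyadic_floor n t)| <= K / (1 - r) * r ^+ n.
  move=> tT; have /andP[t0 _] := tT.
  apply: geometric_increments_cvg => //; first by rewrite r0.
  move=> n; rewrite /dyadic_floor.
  have /andP[H1 H2] := dyadic_index_itv n t0.
  have /andP[H3 H4] := dyadic_index_itv n.+1 t0.
  have HT := dyadic_index_le n.+1 tT.
  have -> : dyadic_point n (dyadic_index n t) =
      dyadic_point n.+1 (2 * dyadic_index n t).
    rewrite /dyadic_point natrM exprS; congr (_ * _); field.
    by rewrite gt_eqF.
  have lo : (2 * dyadic_index n t < (dyadic_index n.+1 t).+1)%N.
    rewrite -(ltr_nat R) (le_lt_trans _ H4)// natrM exprS mulrCA ler_pM2l//.
  have hi : (dyadic_index n.+1 t < 2 * (dyadic_index n t).+1)%N.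
    rewrite -(ltr_nat R) (le_lt_trans H3)// natrM exprS mulrCA ltr_pM2l//.
  move: lo hi HT; set i := dyadic_index n.+1 t; set j := dyadic_index n t => lo hi HT.
  have [iE|iE] := nat_between_double lo hi.
    by rewrite iE subrr normr0 mulr_ge0 ?exprn_ge0 ?(ltW r0).
  by rewrite iE; apply: hy; rewrite -iE.
have [z hz] : exists z : R -> R, forall t, 0 <= t <= T ->
    y (dyadic_floor n t) @[n --> \oo] --> z t /\
    forall n, `|z t - y (dyadic_floor n t)| <= K / (1 - r) * r ^+ n.
  suff /choice[z hz] : forall t, exists l : R, 0 <= t <= T ->
      y (dyadic_floor n t) @[n --> \oo] --> l /\
      forall n, `|l - y (dyadic_floor n t)| <= K / (1 - r) * r ^+ n by exists z.
  move=> t; have [tT|ntT] := boolP (0 <= t <= T); last by exists 0.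
  by have [l ? ?] := chain t tT; exists l.
exists z => [t /hz[]//|].
pose c := K / (1 - r).
have c0 : 0 <= c by rewrite divr_ge0// subr_ge0 ltW.
(* 2 c pays for the two tails and [K] for the adjacent floors; the other factor comes from 2^-n < 2
   (t - s) / T. *)
pose Q := (2 * c + K) * (2 / T) `^ lambda.
have Q0 : 0 <= Q by rewrite mulr_ge0 ?powR_ge0// addr_ge0// mulr_ge0.
have main s t : 0 <= s -> s < t -> t <= T -> `|z t - z s| <= Q * (t - s) `^ lambda.
  move=> s0 st tT.
  have t0 : 0 <= t by rewrite (le_trans s0) ?ltW.
  have [ht1 ht2] := hz t (introT andP (conj t0 tT)).
  have [hs1 hs2] := hz s (introT andP (conj s0 (le_trans (ltW st) tT))).
  pose h := (t - s) / T.
  have h0 : 0 < h by rewrite divr_gt0 ?subr_gt0.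
  have h1 : h <= 1 by rewrite ler_pdivrMr// mul1r; lra.
  have exn : exists n, 2^-1 ^+ n.+1 < h.
    have : (GRing.exp (2^-1 : R)) @ \oo --> 0.
      by apply: cvg_expr; rewrite ger0_norm// invf_lt1// ltr1n.
    move=> /cvgrPdist_lt /(_ h h0) [N _ /(_ N.+1 (leqnSn N))] /=.
    by rewrite sub0r normrN ger0_norm ?exprn_ge0//; exists N.
  case: (ex_minnP exn) => n n1 nmin.
  have n2 : h <= 2^-1 ^+ n.
    case: n nmin {n1} => [|n] nmin; first by rewrite expr0.
    by rewrite leNgt; apply/negP => /nmin; rewrite ltnn.
  have close : `|y (dyadic_floor n t) - y (dyadic_floor n s)| <= K * r ^+ n.
    have tT' : 0 <= t <= T by rewrite t0 tT.
    have /andP[H1 H2] := dyadic_index_itv n t0.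
    have /andP[H3 H4] := dyadic_index_itv n s0.
    have HT := dyadic_index_le n tT'.
    have hn : t / T * 2 ^+ n <= s / T * 2 ^+ n + 1.
      rewrite -lerBlDl -mulrBl -mulrBl -/h -ler_pdivlMr ?(p2 n)// mul1r.
      by rewrite -exprVn.
    have st' : s / T * 2 ^+ n <= t / T * 2 ^+ n.
      by rewrite ler_pM2r ?(p2 n)// ler_pM2r ?invr_gt0// ltW.
    have lo : (dyadic_index n s < (dyadic_index n t).+1)%N.
      by rewrite -(ltr_nat R); lra.
    have hi : (dyadic_index n t < (dyadic_index n s).+2)%N.
      rewrite -(ltr_nat R); apply: le_lt_trans H1 _; apply: le_lt_trans hn _.
      by rewrite -[ltRHS]natr1 ltrD2r.
    rewrite /dyadic_floor.
    move: lo hi HT; set i := dyadic_index n t; set j := dyadic_index n s => lo hi HT.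
    have [ij|ij] := nat_between_succ lo hi.
      by rewrite ij subrr normr0 mulr_ge0 ?exprn_ge0 ?(ltW r0).
    by rewrite ij; apply: hy; rewrite -ij.
  have rn : r ^+ n <= (2 / T) `^ lambda * (t - s) `^ lambda.
    rewrite -powRM ?divr_ge0 ?(ltW hT) ?subr_ge0 ?(ltW st)//.
    have -> : r ^+ n = (2^-1 ^+ n) `^ lambda.
      have -> : r = 2^-1 `^ lambda by rewrite -powR_inv1// -powRrM mulN1r.
      by rewrite expr_powR.
    rewrite ge0_ler_powR ?nnegrE ?(ltW l0) ?exprn_ge0 ?mulr_ge0 ?invr_ge0 ?(ltW hT) ?subr_ge0 ?(ltW st)//.
    have -> : 2 / T * (t - s) = 2 * h by rewrite /h; ring.
    by move: n1; rewrite exprS => ?; lra.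
  have := ht2 n; have := hs2 n; rewrite -/c => Hs Ht.
  have -> : z t - z s = (z t - y (dyadic_floor n t)) - (z s - y (dyadic_floor n s))
     + (y (dyadic_floor n t) - y (dyadic_floor n s)) by ring.
  apply: le_trans (ler_normD _ _) _.
  apply: le_trans (lerD (ler_normB _ _) close) _.
  apply: (@le_trans _ _ ((2 * c + K) * r ^+ n)).
    by rewrite mulrDl lerD2r mulrDl mul1r mulrDl lerD.
  by rewrite /Q -mulrA ler_wpM2l// addr_ge0// mulr_ge0.
exists Q => s t; rewrite /= !in_itv/= => /andP[s0 sT] /andP[t0 tT].
have [st|ts|->] := ltgtP s t; last by rewrite subrr normr0 mulr_ge0 ?powR_ge0.
  by rewrite [in leRHS]gtr0_norm ?subr_gt0//; exact: main.
by rewrite distrC [`|t - s|]distrC [in leRHS]gtr0_norm ?subr_gt0//; exact: main.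
Qed.

End dyadic_chaining.

(** The sum [S] of (|X n k| / r^n)^p over all n and k < N n, with r = 2^(-lambda), has finite mean:
    the moments decay like 2^(- n p m), the weights grow like 2^(n p lambda), and of the exponent p
    (m - lambda) >= 2 one unit pays for the at most 2^n terms of level n while another leaves
    2^(-n). Where [S] is finite, K = S^(1/p) dominates every single term. *)
Lemma ae_geometric_bound (d : measure_display) (U : measurableType d)
    (R : realType) (P : probability U R) (X : nat -> nat -> U -> R)
    (N : nat -> nat) (C T p m lambda : R) :
  0 < T -> 0 < p -> 0 <= C -> 2 <= p * (m - lambda) ->
  (forall n, (N n <= 2 ^ n)%N) -> (forall n k, measurable_fun setT (X n k)) ->
  (forall n k, (k < N n)%N ->
     \int[P]_w (`|X n k w| `^ p)%:E <= (C * (T / 2 ^+ n) `^ (p * m))%:E)%E ->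
  {ae P, forall w, exists2 K : R, 0 <= K &
     forall n k, (k < N n)%N -> `|X n k w| <= K * (2 `^ (- lambda)) ^+ n}.
Proof.
move=> T0 p0 C0 pm N2 mX EX; set r := 2 `^ (- lambda).
have r0 : 0 < r by rewrite powR_gt0.
pose q n := (r ^+ n) `^ p.
have q0 n : 0 < q n by rewrite powR_gt0// exprn_gt0.
(* The factor 2 adapts the level bound to the form A / 2^(n+1), whose sum over n is at most A. *)
pose A := 2 * (C * T `^ (p * m)).
have A0 : 0 <= A by rewrite !mulr_ge0 ?powR_ge0.
have num n : 2 ^+ n * ((q n)^-1 * (C * (T / 2 ^+ n) `^ (p * m))) <= A / (2 ^ n.+1)%:R.
  set h : R := 2^-1 ^+ n.
  have h0 : 0 < h by rewrite exprn_gt0// invr_gt0.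
  have h1 : h <= 1 by rewrite exprn_ile1// ?invr_ge0// invf_le1// ler1n.
  have hE : 2 ^+ n = h^-1 by rewrite /h exprVn invrK.
  have qE : q n = h `^ (lambda * p).
    have rE : r = 2^-1 `^ lambda by rewrite -powR_inv1// -powRrM mulN1r.
    by rewrite /q rE expr_powR// -powRrM.
  rewrite natrX exprS hE invrK powRM ?(ltW T0) ?(ltW h0)// qE /A.
  have hp0 : 0 < h `^ (lambda * p) by rewrite powR_gt0.
  have H : h `^ (p * m) <= h ^+ 2 * h `^ (lambda * p).
    rewrite -(powR_mulrn 2 (ltW h0)) -powRD; last by apply/implyP => _; rewrite gt_eqF.
    apply: ger_powR; first by rewrite h0.
    by move: pm; rewrite mulrBr [p * lambda]mulrC => ?; lra.
  have -> : 2 * (C * T `^ (p * m)) / (2 * h^-1) = C * T `^ (p * m) * h.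
    by field; rewrite gt_eqF.
  have -> : h^-1 * ((h `^ (lambda * p))^-1 * (C * (T `^ (p * m) * h `^ (p * m)))) =
      C * T `^ (p * m) * (h `^ (p * m) / (h * h `^ (lambda * p))).
    by field; rewrite !gt_eqF.
  rewrite ler_wpM2l ?mulr_ge0 ?powR_ge0// ler_pdivrMr ?mulr_gt0//.
  by rewrite mulrA -expr2.
pose u n w : \bar R := (\sum_(k < N n) ((q n)^-1 * `|X n k w| `^ p)%:E)%E.
have t0 n k w : 0 <= (q n)^-1 * `|X n k w| `^ p.
  by rewrite mulr_ge0 ?powR_ge0// invr_ge0 ltW.
have mp n k : measurable_fun setT (fun w => (`|X n k w| `^ p)%:E).
  apply/measurable_EFinP; apply: (measurableT_comp (measurable_powR p)).
  exact: measurableT_comp.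
have mt n k : measurable_fun setT (fun w => ((q n)^-1 * `|X n k w| `^ p)%:E).
  apply/measurable_EFinP; apply: measurable_funM => //.
  by apply/measurable_EFinP; exact: mp.
have u0 n w : (0 <= u n w)%E by apply: sume_ge0 => k _; rewrite lee_fin.
have mu n : measurable_fun setT (u n) by apply: emeasurable_sum => k.
have iu n : (\int[P]_w u n w <= (A / (2 ^ n.+1)%:R)%:E)%E.
  rewrite ge0_integral_sum//; last by move=> k w _; rewrite lee_fin.
  apply: le_trans (_ : (\sum_(k < N n) ((q n)^-1 * (C * (T / 2 ^+ n) `^ (p * m)))%:E <= _)%E).
    apply: lee_sum => k _; under eq_integral do rewrite EFinM.
    rewrite ge0_integralZl_EFin ?invr_ge0 ?(ltW (q0 n))//.
    rewrite [leRHS]EFinM lee_wpmul2l ?lee_fin ?invr_ge0 ?(ltW (q0 n))//.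
    exact: EX.
  rewrite sumEFin lee_fin sumr_const card_ord; apply: le_trans (num n).
  rewrite -[leLHS]mulr_natl ler_wpM2r//.
    by rewrite mulr_ge0 ?invr_ge0 ?(ltW (q0 n))// mulr_ge0 ?powR_ge0.
  by rewrite -natrX ler_nat.
pose S w : \bar R := (\sum_(n <oo) u n w)%E.
have S0 w : (0 <= S w)%E by apply: nneseries_ge0.
have mS : measurable_fun setT S.
  by apply: ge0_emeasurable_sum.
have iS : P.-integrable setT S.
  apply/integrableP; split => //.
  under eq_integral do rewrite gee0_abs//.
  rewrite /S integral_nneseries//.
  apply: (@le_lt_trans _ _ A%:E); last exact: ltry.
  apply: le_trans (epsilon_trick0 _ A0); apply: lee_nneseries => n *; last exact: iu.
  by apply: integral_ge0.
apply: filterS (integrable_ae measurableT iS) => w /(_ Logic.I) Sfin.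
exists (fine (S w) `^ p^-1) => [|n k kN]; first exact: powR_ge0.
have Sk : (q n)^-1 * `|X n k w| `^ p <= fine (S w).
  rewrite -lee_fin fineK//; apply: le_trans (_ : u n w <= _)%E.
    by rewrite /u (bigD1 (Ordinal kN))//= leeDl// sume_ge0// => i _; rewrite lee_fin.
  apply: le_trans (nneseries_lim_ge n.+1 _) => [|i _ _]; last exact: u0.
  by rewrite big_nat_recr//= leeDr// sume_ge0.
have Sw0 : 0 <= fine (S w) by rewrite fine_ge0.
rewrite mulrC ler_pdivrMr// in Sk.
have pV : p * p^-1 = 1 by rewrite divff// gt_eqF.
have xE (x : R) : 0 <= x -> x = (x `^ p) `^ p^-1 by move=> x0; rewrite -powRrM pV powRr1.
rewrite [leLHS](xE _ (normr_ge0 _)) [X in _ * X](xE _ (exprn_ge0 n (ltW r0))).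
rewrite -/(q n) -powRM ?(ltW (q0 n))//.
by rewrite ge0_ler_powR ?nnegrE ?powR_ge0 ?invr_ge0 ?(ltW p0)// mulr_ge0// ltW.
Qed.

Lemma powR_le_powR (R : realType) (x T a b : R) : 0 < x -> x <= T -> a <= b ->
  x `^ b <= T `^ (b - a) * x `^ a.
Proof.
move=> x0 xT ab; rewrite (_ : x `^ b = x `^ (b - a) * x `^ a); last first.
  rewrite -powRD ?subrK//.
  by apply/implyP => _; rewrite gt_eqF.
rewrite ler_wpM2r ?powR_ge0//.
apply: ge0_ler_powR; rewrite ?nnegrE ?subr_ge0 ?(ltW x0)//.
exact: le_trans (ltW x0) xT.
Qed.

Lemma holder_on_le (R : realType) (T a b : R) (f : R -> R) : 0 < a -> a <= b ->
  holder_on `[0, T] b f -> holder_on `[0, T] a f.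
Proof.
move=> a0 ab [K hK]; exists (`|K| * T `^ (b - a)) => s t sT tT.
have [->|st] := eqVneq s t.
  by rewrite !subrr normr0 !mulr_ge0 ?powR_ge0.
apply: le_trans (hK s t sT tT) _; rewrite -mulrA.
apply: (@le_trans _ _ (`|K| * `|t - s| `^ b)).
  by rewrite ler_wpM2r ?powR_ge0// ler_norm.
rewrite ler_wpM2l//; apply: powR_le_powR => //.
  by rewrite normr_gt0 subr_eq0 eq_sym.
move: sT tT; rewrite /= !in_itv/= => /andP[s0 sT] /andP[t0 tT].
by rewrite ler_norml; apply/andP; split; lra.
Qed.

(** * Kolmogorov's continuity criterion *)

Section kolmogorov.
Context (R : realType) (d : measure_display) (Omega : measurableType d).
Context (P : probability Omega R) (T m : R) (Y : R -> {RV P >-> R}).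
Hypotheses (hT : 0 < T) (hm : 0 < m).
Hypothesis hY : forall p : R, 2 <= p -> exists2 C : R, 0 <= C &
  forall s t : R, 0 <= s -> s < t -> t <= T ->
    (\int[P]_w (`|Y t w - Y s w| `^ p)%:E <= (C * (t - s) `^ (p * m))%:E)%E.

(* The limit superior is measurable in [w] without any convergence assumption; [fine]
   sends an infinite one to 0. *)
Let dyadic_lim t w : R :=
  fine (limn_esup (fun n => (Y (dyadic_floor T n t) w)%:E)).

Let measurable_dyadic_lim t : measurable_fun setT (dyadic_lim t).
Proof.
apply: measurableT_comp => //; apply: measurable_fun_limn_esup => n.
exact/measurable_EFinP.
Qed.

Let dyadic_limE t w l :
  Y (dyadic_floor T n t) w @[n --> \oo] --> l -> dyadic_lim t w = l.
Proof.
move=> cv.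
have cvE : (Y (dyadic_floor T n t) w)%:E @[n --> \oo] --> l%:E.
  by apply/fine_cvgP; split; [exact: nearW|exact: cv].
rewrite /dyadic_lim is_cvg_limn_esupE; first by rewrite (cvg_lim _ cvE).
by apply/cvg_ex; exists l%:E.
Qed.

Let moment_dyadic p C n s t : 0 < p -> 0 <= C ->
  (forall s t : R, 0 <= s -> s < t -> t <= T ->
    (\int[P]_w (`|Y t w - Y s w| `^ p)%:E <= (C * (t - s) `^ (p * m))%:E)%E) ->
  0 <= s -> s <= t -> t <= T -> t - s <= T / 2 ^+ n ->
  (\int[P]_w (`|Y t w - Y s w| `^ p)%:E <= (C * (T / 2 ^+ n) `^ (p * m))%:E)%E.
Proof.
move=> p0 C0 hC s0; rewrite le_eqVlt => /predU1P[->|st] tT hts.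
  under eq_integral do rewrite subrr normr0 powR0 ?gt_eqF//.
  by rewrite integral0 lee_fin mulr_ge0 ?powR_ge0.
apply: le_trans (hC s t s0 st tT) _; rewrite lee_fin ler_wpM2l//.
have ts0 : 0 <= t - s by rewrite subr_ge0 ltW.
have Tn0 := le_trans ts0 hts.
by apply: ge0_ler_powR; rewrite ?nnegrE// mulr_ge0 ?(ltW p0) ?(ltW hm).
Qed.

Let exponent lambda : lambda < m -> exists p : R,
  [/\ 2 <= p, 0 < p & 2 <= p * (m - lambda)].
Proof.
rewrite -subr_gt0 => ml; have i0 : 0 < 2 / (m - lambda) by rewrite divr_gt0.
(* The first summand secures 2 <= p, the second 2 <= p (m - lambda). *)
exists (2 + 2 / (m - lambda)); split; first by rewrite lerDl ltW.
  by rewrite addr_gt0.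
by rewrite mulrDl divfK ?gt_eqF// lerDr mulr_ge0// ltW.
Qed.

(** [ae_geometric_bound] with one variable per level, the difference of Y at [t] and at its dyadic
    floor, shows that the values at the floors converge to Y t almost surely, for each fixed [t].
    The order m / 2 is an arbitrary choice in ]0, m[. *)
Let ae_modification t : 0 <= t <= T -> {ae P, forall w, dyadic_lim t w = Y t w}.
Proof.
move=> /andP[t0 tT].
have l0 : 0 < m / 2 by rewrite divr_gt0.
have [p [p2 p0 pm]] : exists p : R, [/\ 2 <= p, 0 < p & 2 <= p * (m - m / 2)].
  by apply: exponent; rewrite ltr_pdivrMr// ltr_pMr// ltr1n.
have [C C0 hC] := hY p2.
have : {ae P, forall w, exists2 K : R, 0 <= K & forall n k, (k < 1)%N ->
    `|Y t w - Y (dyadic_floor T n t) w| <= K * (2 `^ (- (m / 2))) ^+ n}.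
  apply: (@ae_geometric_bound _ _ _ P (fun n _ w => Y t w - Y (dyadic_floor T n t) w)
    (fun=> 1%N) C T p m (m / 2)) => //.
  - by move=> n; rewrite expn_gt0.
  - by move=> n _; exact: measurable_funB.
  - move=> n k _; have [f1 f2] := dyadic_floor_itv hT n t0.
    by apply: moment_dyadic => //; exact: dyadic_floor_ge0.
apply: filterS => w [K K0 hK]; apply: dyadic_limE.
set r := 2 `^ _ in hK.
have r0 : 0 < r by rewrite powR_gt0.
have r1 : r < 1 by exact: powR2N_lt1.
have cv : K * r ^+ n @[n --> \oo] --> 0.
  rewrite -[0](mulr0 K); apply: cvgM; first exact: cvg_cst.
  by apply: cvg_expr; rewrite ger0_norm// ltW.
apply/cvgrPdist_le => e e0; move/cvgrPdist_le : cv => /(_ e e0).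
apply: filterS => n; rewrite sub0r normrN ger0_norm ?mulr_ge0 ?exprn_ge0 ?(ltW r0)//.
by apply: le_trans; exact: (hK n 0).
Qed.

(** [dyadic_holder] is applied path by path; its limit is [dyadic_lim] on [0, T] whatever [lambda],
    so all orders concern the same process. *)
Let ae_holder lambda : 0 < lambda -> lambda < m ->
  {ae P, forall w, holder_on `[0, T] lambda (fun t => dyadic_lim t w)}.
Proof.
move=> l0 lm; have [p [p2 p0 pm]] := exponent lm.
have [C C0 hC] := hY p2.
have : {ae P, forall w, exists2 K : R, 0 <= K & forall n k, (k < 2 ^ n)%N ->
    `|Y (dyadic_point T n k.+1) w - Y (dyadic_point T n k) w|
      <= K * (2 `^ (- lambda)) ^+ n}.
  apply: (@ae_geometric_bound _ _ _ P (fun n k w =>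
     Y (dyadic_point T n k.+1) w - Y (dyadic_point T n k) w)
    (fun n => 2 ^ n)%N C T p m lambda) => //.
  - by move=> n k; exact: measurable_funB.
  - move=> n k kn; have n0 : 0 < 2 ^+ n :> R by rewrite exprn_gt0.
    have E : dyadic_point T n k.+1 - dyadic_point T n k = T / 2 ^+ n.
      by rewrite /dyadic_point -natr1; field; rewrite gt_eqF.
    apply: moment_dyadic => //.
    + by rewrite mulr_ge0 ?divr_ge0 ?(ltW hT) ?(ltW n0).
    + by rewrite -subr_ge0 E divr_ge0 ?(ltW hT) ?(ltW n0).
    + rewrite /dyadic_point ler_piMr ?(ltW hT)// ler_pdivrMr// mul1r.
      by rewrite -natrX ler_nat.
    + by rewrite E.
apply: filterS => w [K K0 hK].
have [z hz [Q hQ]] := dyadic_holder hT (y := fun t => Y t w) l0 K0 hK.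
exists Q => s t sT tT; rewrite /= in sT tT.
rewrite (dyadic_limE (hz s _)); last by move: sT; rewrite in_itv.
by rewrite (dyadic_limE (hz t _)); [exact: hQ|move: tT; rewrite in_itv].
Qed.

Lemma kolmogorov_continuity : exists Y' : R -> {RV P >-> R},
  modification_on `[0, T] Y Y' /\
  {ae P, forall w, holder_up_to `[0, T] m (fun t => Y' t w)}.
Proof.
have [Y' Y'E] : exists Y' : R -> {RV P >-> R}, forall t w, Y' t w = dyadic_lim t w.
  exists (fun t => mfun_Sub (mem_set (measurable_dyadic_lim t))) => t w.
  by [].
exists Y'; split => [t|].
  rewrite /= in_itv/= => /ae_modification; apply: filterS => w.
  by rewrite Y'E.
(* Countably many orders increasing to [m] leave one null set for all lambda < m; [j.+2] keeps
   [la 0] positive. *)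
pose la (j : nat) : R := m * (1 - j.+2%:R^-1).
have la0 j : 0 < la j.
  by rewrite mulr_gt0// subr_gt0 invf_lt1// ltr1n.
have lam j : la j < m by rewrite -[ltRHS]mulr1 ltr_pM2l// ltrBlDr ltrDl invr_gt0.
have : {ae P, forall w, forall j, holder_on `[0, T] (la j) (fun t => dyadic_lim t w)}.
  by apply: ae_foralln => j; exact: ae_holder.
apply: filterS => w hw lambda l0 lm.
have -> : (fun t => Y' t w) = (fun t => dyadic_lim t w) by apply/funext => t.
have e0 : 0 < 1 - lambda / m by rewrite subr_gt0 ltr_pdivrMr// mul1r.
near \oo => j.
apply: (holder_on_le l0 _ (hw j)).
rewrite /la mulrC -ler_pdivrMr//.
have : j.+1%:R^-1 < 1 - lambda / m.
  by near: j; exact: (near_infty_natSinv_lt (PosNum e0)).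
have : (j.+2%:R^-1 : R) <= j.+1%:R^-1 by rewrite lef_pV2 ?posrE// ler_nat.
by move: (j.+2%:R^-1) (j.+1%:R^-1) (lambda / m) => a b c ? ?; lra.
Unshelve. all: by end_near. Qed.

End kolmogorov.

(** * Moments and paths of the Volterra process Y *)

Unset Implicit Arguments.

Theorem lemma5 (R : realType) (d : measure_display)
    (Omega : measurableType d) (P : probability Omega R)
    (T : R) (hT : 0 < T)
    (Z : R -> {RV P >-> R}) (hZ : brownian_motion T Z)
    (g : R -> R -> R)
    (hg : measurable_fun
            [set tu : R * R | 0 < tu.2 /\ tu.2 < tu.1 /\ tu.1 <= T]
            (fun tu : R * R => g tu.1 tu.2))
    (Y : R -> {RV P >-> R})
    (hY : forall t : R, 0 <= t <= T -> is_wiener_integral Z t (g t) (Y t))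
    (alpha beta gamma delta : R)
    (hbeta : - 2^-1 < beta) (hgamma : - 2^-1 < gamma)
    (hsum : - 2^-1 < alpha + beta + gamma) (hdelta : 0 < delta)
    (B1 : exists C : R, forall t u : R, 0 < u -> u < t -> t <= T ->
            `|g t u| <= C * t `^ alpha * u `^ beta * (t - u) `^ gamma)
    (B2 : exists h : R -> R -> R -> R,
            (forall t s u : R, 0 < u -> u < s -> s < t -> t <= T ->
               `|g t u - g s u| <= `|t - s| `^ delta * h t s u) /\
            (ereal_sup
               [set (\int[lebesgue_measure]_(u in `[0%R, st.1])
                       (`|h st.2 st.1 u| ^+ 2)%:E)%E
                | st in [set st : R * R |
                          0 < st.1 /\ st.1 < st.2 /\ st.2 <= T]%R]
             < +oo)%E) :
  (forall p : R, 2 <= p ->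
     exists C : R, forall s t : R, 0 <= s -> s < t -> t <= T ->
       ('E_P[fun w => (`|Y t w - Y s w| `^ p)%R]
        <= (C * (t - s) `^
                  (p * Num.min (kappa alpha beta gamma + 2^-1) delta))%:E)%E)
  /\
  (- 2^-1 < kappa alpha beta gamma ->
     exists Y' : R -> {RV P >-> R},
       modification_on `[0, T] Y Y' /\
       {ae P, forall w,
          holder_up_to `[0, T]
            (Num.min (kappa alpha beta gamma + 2^-1) delta)
            (fun t => Y' t w)}).
Proof.
set m := Num.min _ _.
have [K1 K10 hK1] := kernel_diff_le hg B2.
have [K2 K20 hK2] := kernel_tail_le hT hg hbeta hgamma B1.
have kappa0 : 0 < kappa alpha beta gamma + 2^-1.
  by rewrite -ltrBlDr sub0r /kappa; case: ifP.
have m0 : 0 < m by rewrite lt_min kappa0.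
have mk : 2 * m <= 2 * (kappa alpha beta gamma + 2^-1).
  by rewrite ler_pM2l// /m ge_min lexx.
have md : 2 * m <= 2 * delta by rewrite ler_pM2l// /m ge_min lexx orbT.
(* The powers of [T] lower the exponents 2 delta and 2 (kappa + 1/2) to 2 m. The summand 1 makes [Q]
   positive, as the bound [W] in [wiener_incr_moment] has to be. *)
pose Q := K1 * T `^ (2 * delta - 2 * m) +
  K2 * T `^ (2 * (kappa alpha beta gamma + 2^-1) - 2 * m) + 1.
have Q0 : 0 < Q by rewrite ltr_wpDl// addr_ge0// mulr_ge0 ?powR_ge0.
have kernel s t : 0 <= s -> s < t -> t <= T ->
  (\int[lebesgue_measure]_(u in `[0%R, s]) (`|g t u - g s u| ^+ 2)%:E +
   \int[lebesgue_measure]_(u in `]s, t]) (`|g t u| ^+ 2)%:E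
     <= ((Num.sqrt Q * (t - s) `^ m) ^+ 2)%:E)%E.
  move=> s0 st tT; have ts0 : 0 < t - s by rewrite subr_gt0.
  have tsT : t - s <= T by rewrite lerBlDr (le_trans tT)// lerDl.
  apply: le_trans (leeD (hK1 s t s0 st tT) (hK2 s t s0 st tT)) _.
  rewrite -EFinD lee_fin exprMn sqr_sqrtr ?(ltW Q0)// sqr_powR /Q.
  rewrite [leRHS]mulrDl [X in _ <= X + _]mulrDl mul1r.
  rewrite -[leLHS]addr0; apply: lerD; last exact: powR_ge0.
  by apply: lerD; rewrite -mulrA ler_wpM2l//; exact: powR_le_powR.
(* The constant of [wiener_incr_moment] for W = sqrt Q (t - s)^m, after (t - s)^(p m) has been split
   off. *)
pose Cp p := 2 `^ p * (p `^ p * 2 * expR 2^-1 * (2 * Num.sqrt Q) `^ p).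
have moment p : 2 <= p -> forall s t : R, 0 <= s -> s < t -> t <= T ->
    (\int[P]_w (`|Y t w - Y s w| `^ p)%:E <= (Cp p * (t - s) `^ (p * m))%:E)%E.
  move=> p2 s t s0 st tT; have t0 := le_trans s0 (ltW st).
  have sT := le_trans (ltW st) tT.
  have ts0 : 0 < t - s by rewrite subr_gt0.
  have W0 : 0 < Num.sqrt Q * (t - s) `^ m by rewrite mulr_gt0 ?sqrtr_gt0 ?powR_gt0.
  apply: le_trans (wiener_incr_moment hZ p2 s0 (ltW st) tT W0
    (measurable_kernel hg tT) (measurable_kernel hg sT)
    (hY t _) (hY s _) (kernel s t s0 st tT)) _.
  - by rewrite t0.
  - by rewrite s0.
  have -> : (2 * (Num.sqrt Q * (t - s) `^ m)) `^ p =
      (2 * Num.sqrt Q) `^ p * (t - s) `^ (p * m).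
    by rewrite mulrA powRM ?mulr_ge0 ?sqrtr_ge0 ?powR_ge0// [p * m]mulrC powRrM.
  by rewrite /Cp !mulrA.
split=> [p p2|_].
  by exists (Cp p) => s t s0 st tT; rewrite unlock; exact: moment.
apply: kolmogorov_continuity => // p p2; exists (Cp p); last exact: moment.
by rewrite /Cp !mulr_ge0 ?powR_ge0 ?expR_ge0// (le_trans _ p2).
Qed.
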